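(* For any integer $v \ge 8$ with $v \notin \{9,11,23\}$, and for every integer $c \in [v, v^{2}] \setminus \{v+1\}$, there exists a $\mathrm{QLS}(v)$ (quantum Latin square of order $v$) with cardinality $c$.
   Context: $\mathcal{H}_v=\mathbb{C}^v$ denotes the $v$-dimensional complex Hilbert space. A quantum Latin square of order $v$, denoted $\mathrm{QLS}(v)$, is a $v\times v$ array whose entries are unit column vectors of $\mathcal{H}_v$ such that the entries of each row and of each column form an orthonormal basis of $\mathcal{H}_v$. Two unit vectors $|\phi\rangle,|\psi\rangle\in\mathcal{H}_v$ are regarded as identical if there is a real $\theta\in[0,2\pi)$ with $|\phi\rangle=e^{\mathrm{i}\theta}|\psi\rangle$; otherwise they are distinct. The cardinality of a $\mathrm{QLS}(v)$ is the number of distinct vectors (in this sense, i.e. up to a global phase) appearing in the array. *)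

(* Defs.v *)
From HB Require Import structures.
From mathcomp Require Import all_boot all_order all_algebra complex.
From mathcomp Require Import boolp reals trigo.
Set Implicit Arguments.
Unset Strict Implicit.
Unset Printing Implicit Defensive.
Import Order.TTheory GRing.Theory Num.Theory.
Local Open Scope ring_scope.
Local Open Scope complex_scope.

(* Conjugate-linear in the first argument, as in Dirac's <u|w>. *)
Definition braket (R : realType) (v : nat) (u w : 'cV[R[i]]_v) : R[i] :=
  \sum_(k < v) (u k 0)^* * w k 0.

Definition orthonormal_basis (R : realType) (v : nat)
    (b : v.-tuple 'cV[R[i]]_v) : Prop :=
  (forall i j : 'I_v, braket (tnth b i) (tnth b j) = (i == j)%:R) /\
  basis_of fullv b.

Definition is_QLS (R : realType) (v : nat) (L : 'M['cV[R[i]]_v]_v) : Prop :=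
  (forall i : 'I_v, orthonormal_basis [tuple L i j | j < v]) /\
  (forall j : 'I_v, orthonormal_basis [tuple L i j | i < v]).

Definition expi (R : realType) (theta : R) : R[i] := cos theta +i* sin theta.

Definition phase_eq (R : realType) (v : nat) (x y : 'cV[R[i]]_v) : Prop :=
  exists theta : R, 0 <= theta < 2 * pi /\ x = expi theta *: y.

(* The distinct vectors are counted as the classes of cells of the array under
   "the two entries agree up to a global phase". *)
Definition QLS_card (R : realType) (v : nat) (L : 'M['cV[R[i]]_v]_v) : nat :=
  #|equivalence_partition
      (fun p q : 'I_v * 'I_v => `[< phase_eq (L p.1 p.2) (L q.1 q.2) >])
      [set: 'I_v * 'I_v]|.

(* Main.v *)
(** A subsquare of a quantum Latin square whose entries span a coordinate
    subspace may be replaced by any quantum Latin square of that subspace, in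
    particular by a rotated one.  Complex reflections x + (u - 1) <z,x>/<z,z> z
    fix the rays orthogonal or parallel to z, and for all but finitely many
    unit scalars u they move all other rays out of a given finite set.  So a
    square of order d containing the standard basis and r further rays can be
    placed in such a way that it contributes exactly r + k new rays, for any
    k <> 1 with k <= d.  Here r = 0 for a Latin square and r = d^2 - d for the
    square w^(ik + j pi(k)), w a primitive d-th root of unity and pi the
    transposition of 0 and 1, whose d^2 rays are all distinct.

    For v = n m + s take a Latin square of order n with s disjoint
    transversals; blow up its cells to squares of order m, those on the t-th
    transversal to squares of order m + 1 that share one cell with a hole of
    order s.  Keeping the standard basis in one block per symbol, the numbers of
    new rays add up independently.  For v >= 56 one can take m = 4, n odd and
    4 <= s <= 11; the smaller orders have individual choices of (n, m, s).  When
    s = 2 the hole costs two rays, and the two largest values come from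
    other block decompositions of v.  The orders 8 and 10 are 2 x 2 block arrays;
    they need additional squares of orders 4 and 5, and one pair of squares that
    differ by a reflection in one of their own entries. *)

Require Import Defs.
From mathcomp Require Import all_boot all_order all_algebra complex finmap.
From mathcomp Require Import perm cyclic separable cyclotomic.
From mathcomp Require Import boolp reals trigo ring lra zify.
Set Implicit Arguments.
Unset Strict Implicit.
Unset Printing Implicit Defensive.
Import Order.TTheory GRing.Theory Num.Theory.
Local Open Scope ring_scope.

(** * Rays and reflections *)

Section Vectors.
Variable C : numClosedFieldType.

Definition unimod (u : C) := u^* * u = 1.

Section Space.
Variable D : finType.
Notation vec := {ffun D -> C}.

Definition ip (x y : vec) : C := \sum_d (x d)^* * y d.
Definition vscale (c : C) (x : vec) : vec := [ffun d => c * x d].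
Definition vadd (x y : vec) : vec := [ffun d => x d + y d].
Definition delta (k : D) : vec := [ffun d => (d == k)%:R].
(* Unit vectors agree up to phase iff their projectors are equal; these canonical
   representatives are what gets counted. *)
Definition proj (x : vec) : {ffun D * D -> C} := [ffun p => x p.1 * (x p.2)^*].
Definition same (x y : vec) := exists2 u, unimod u & x = vscale u y.

Lemma ipC x y : (ip x y)^* = ip y x.
Proof.
by rewrite /ip rmorph_sum; apply: eq_bigr => d _; rewrite rmorphM /= conjCK mulrC.
Qed.

Lemma ipZr c x y : ip x (vscale c y) = c * ip x y.
Proof. by rewrite /ip mulr_sumr; apply: eq_bigr => d _; rewrite ffunE mulrCA. Qed.

Lemma ipZl c x y : ip (vscale c x) y = c^* * ip x y.
Proof. by rewrite -ipC ipZr rmorphM /= ipC. Qed.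

Lemma ipDr x y z : ip x (vadd y z) = ip x y + ip x z.
Proof. by rewrite /ip -big_split; apply: eq_bigr => d _; rewrite ffunE mulrDr. Qed.

Lemma ipDl x y z : ip (vadd x y) z = ip x z + ip y z.
Proof. by rewrite -ipC ipDr rmorphD /= !ipC. Qed.

Lemma ip_deltal k x : ip (delta k) x = x k.
Proof.
rewrite /ip (bigD1 k) //= ffunE eqxx conjC1 mul1r big1 ?addr0 // => d ne.
by rewrite ffunE (negbTE ne) conjC0 mul0r.
Qed.

Lemma ip_delta k k' : ip (delta k) (delta k') = (k == k')%:R.
Proof. by rewrite ip_deltal ffunE. Qed.

Lemma ip_eq0 x : (ip x x == 0) = (x == [ffun=> 0]).
Proof.
apply/idP/idP => [|/eqP->]; last first.
  by rewrite /ip big1 // => d _; rewrite ffunE mulr0.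
rewrite psumr_eq0 => [/allP h|d _]; last by rewrite mulrC mul_conjC_ge0.
apply/eqP/ffunP => d; rewrite ffunE; apply/eqP.
by move: (h d (mem_index_enum _)); rewrite mulrC mul_conjC_eq0.
Qed.

Lemma vscale1 x : vscale 1 x = x.
Proof. by apply/ffunP => d; rewrite ffunE mul1r. Qed.

Lemma vscaleA a b x : vscale a (vscale b x) = vscale (a * b) x.
Proof. by apply/ffunP => d; rewrite !ffunE mulrA. Qed.

Lemma unimod1 : unimod 1.
Proof. by rewrite /unimod conjC1 mulr1. Qed.

Lemma unimodM a b : unimod a -> unimod b -> unimod (a * b).
Proof. by rewrite /unimod rmorphM /= => ha hb; rewrite mulrACA ha hb mulr1. Qed.

Lemma unimod_conj a : unimod a -> unimod a^*.
Proof. by rewrite /unimod conjCK mulrC. Qed.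

Lemma unimod_neq0 a : unimod a -> a != 0.
Proof. by move=> h; apply/eqP => a0; move/eqP: h; rewrite a0 mulr0 eq_sym oner_eq0. Qed.

Lemma same_refl x : same x x.
Proof. by exists 1; rewrite ?vscale1; first exact: unimod1. Qed.

Lemma same_sym x y : same x y -> same y x.
Proof.
by case=> u hu ->; exists u^*; [exact: unimod_conj | rewrite vscaleA hu vscale1].
Qed.

Lemma same_trans y x z : same x y -> same y z -> same x z.
Proof.
by move=> [u hu ->] [w hw ->]; exists (u * w); [exact: unimodM | rewrite vscaleA].
Qed.

Lemma proj_same x y : same x y -> proj x = proj y.
Proof.
case=> u hu ->; apply/ffunP => p; rewrite !ffunE rmorphM /= mulrACA.
by rewrite [u * _]mulrC hu mul1r.
Qed.

Lemma same_proj x y : ip x x = 1 -> ip y y = 1 -> proj x = proj y -> same x y.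
Proof.
move=> hx hy e; have ex : x = vscale (ip y x) y.
  apply/ffunP => a; rewrite ffunE -[LHS]mulr1 -hx /ip mulr_sumr mulr_suml.
  apply: eq_bigr => b _; have /ffunP/(_ (a, b)) := e; rewrite !ffunE /= => h.
  by rewrite mulrA h; ring.
exists (ip y x) => //.
have h : ip (vscale (ip y x) y) (vscale (ip y x) y) = 1 by rewrite -ex.
by move: h; rewrite ipZr ipZl hy mulr1 mulrC.
Qed.

Lemma unit_par x y c : ip x x = 1 -> ip y y = 1 -> x = vscale c y -> same x y.
Proof.
move=> hx hy e; exists c => //.
by move: hx; rewrite e ipZr ipZl hy mulr1 mulrC.
Qed.

Definition isom (U : vec -> vec) :=
  (forall x y, ip (U x) (U y) = ip x y) /\ (forall c x, U (vscale c x) = vscale c (U x)).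

Lemma isom_comp U V : isom U -> isom V -> isom (U \o V).
Proof.
move=> [u1 u2] [v1 v2]; split=> [x y|c x] /=; first by rewrite u1 v1.
by rewrite v2 u2.
Qed.

Lemma isom_same U x y : isom U -> same x y -> same (U x) (U y).
Proof. by case=> _ hU [u hu ->]; exists u; rewrite ?hU. Qed.

(** Inner products alone decide: the phase [u] gives <x, u y> = 1, so x - u y has squared norm 1 - 1
    - 1 + 1 = 0. *)
Lemma isom_same_inv U x y :
  isom U -> ip x x = 1 -> ip y y = 1 -> same (U x) (U y) -> same x y.
Proof.
move=> [h1 h2] hx hy [u hu e].
have e2 : ip x (vscale u y) = 1 by rewrite -h1 h2 -e h1.
exists u => //; have hz : ip (vscale u y) (vscale u y) = 1.
  by rewrite -h1 h2 -e h1.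
move: e2 hz; move: (vscale u y) => w e2 hz.
have e2' : ip w x = 1 by rewrite -ipC e2 conjC1.
have := ip_eq0 (vadd x (vscale (-1) w)).
rewrite !ipDl !ipDr !ipZl !ipZr e2 e2' hz hx rmorphN /= conjC1.
rewrite !mulN1r opprK addrN addNr addr0 eqxx => /esym/eqP/ffunP h.
apply/ffunP => d; have := h d; rewrite !ffunE mulN1r => /eqP.
by rewrite subr_eq0 => /eqP.
Qed.

Definition refl (z : vec) (u : C) (x : vec) : vec :=
  vadd x (vscale ((u - 1) * (ip z x / ip z z)) z).

(** The cross terms combine to (u^* u - 1) <x,z> <z,y> / <z,z>, which vanishes for unimodular
    [u]. *)
Lemma isom_refl z u : unimod u -> ip z z != 0 -> isom (refl z u).
Proof.
move=> hu nz; split=> [x y|c x]; last first.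
  by apply/ffunP => d; rewrite !ffunE ipZr; ring.
rewrite /refl !(ipDl, ipDr) !ipZr !ipZl !rmorphM /= rmorphV ?unitfE // !ipC.
rewrite rmorphB /= conjC1.
set a := ip z x; set n := ip z z; set b := ip z y.
rewrite -[ip x z]ipC -/a.
have nc : n^* = n by rewrite ipC.
transitivity (ip x y + (u^* * u - 1) * (a^* * b / n)).
  by rewrite nc; field; exact: nz.
by rewrite hu subrr mul0r addr0.
Qed.

Definition moved (z x : vec) := ip z x != 0 /\ forall c, x <> vscale c z.
Definition unmoved (z x : vec) := ip z x = 0 \/ exists c, x = vscale c z.

Lemma unmovedP z x : moved z x \/ unmoved z x.
Proof.
case: (eqVneq (ip z x) 0) => h; first by right; left.
case: (pselect (exists c, x = vscale c z)) => h2; first by right; right.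
by left; split=> // c e; apply: h2; exists c.
Qed.

Lemma refl_unmoved z u x :
  unimod u -> ip z z != 0 -> unmoved z x -> same (refl z u x) x.
Proof.
move=> hu nz [h|[c ->]].
  exists 1; first exact: unimod1.
  by apply/ffunP => d; rewrite !ffunE h; ring.
exists u => //; apply/ffunP => d; rewrite !ffunE ipZr; field; exact: nz.
Qed.

(** If the two images agree up to a phase w, then (1 - w) x is a multiple of z. As x is not parallel
    to z, w = 1, and comparing the coefficients of z gives u = u'. *)
Lemma refl_inj z x u u' : ip z z != 0 -> moved z x ->
  same (refl z u x) (refl z u' x) -> u = u'.
Proof.
move=> nz [h1 h2] [w _ e].
have e' d : (1 - w) * x d =
    (w * (u' - 1) - (u - 1)) * (ip z x / ip z z) * z d.
  have /ffunP/(_ d) := e; rewrite !ffunE => h.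
  apply/eqP; rewrite -subr_eq0; apply/eqP.
  transitivity (x d + (u - 1) * (ip z x / ip z z) * z d -
    w * (x d + (u' - 1) * (ip z x / ip z z) * z d)); first by ring.
  by rewrite h subrr.
have w1 : w = 1.
  apply/eqP; apply/negPn/negP => w1; have w0 : 1 - w != 0 by rewrite subr_eq0 eq_sym.
  case: (h2 ((1 - w)^-1 * ((w * (u' - 1) - (u - 1)) * (ip z x / ip z z)))).
  by apply/ffunP => d; rewrite ffunE -mulrA -e' mulKf.
have [d zd] : exists d, z d != 0.
  case: (pselect (exists d, z d != 0)) => // h; case/negP: nz.
  rewrite ip_eq0; apply/eqP/ffunP => d; rewrite ffunE.
  by apply/eqP/negPn/negP => zd; apply: h; exists d.
have := e' d; rewrite w1 subrr mul0r => /esym/eqP.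
rewrite mul1r !mulf_eq0 (negbTE zd) (negbTE h1) invr_eq0 (negbTE nz) !orbF.
by rewrite opprB addrA addrNK subr_eq0 => /eqP.
Qed.

End Space.

(** The Cayley transform of the integer [k]: an infinite supply of distinct numbers on the unit
    circle. *)
Definition cayley (k : nat) : C := (1 + k%:R * 'i) / (1 - k%:R * 'i).

Lemma cayley_denominator (k : nat) : (1 - k%:R * 'i != 0 :> C) /\ (1 + k%:R * 'i != 0 :> C).
Proof.
have h : (1 - k%:R * 'i) * (1 + k%:R * 'i) = (1 + k ^ 2)%:R :> C.
  rewrite natrD natrX; transitivity (1 - k%:R ^+ 2 * 'i ^+ 2 : C); first by ring.
  by rewrite sqrCi mulrN1 opprK.
have : (1 - k%:R * 'i) * (1 + k%:R * 'i) != 0 :> C by rewrite h pnatr_eq0.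
by rewrite mulf_eq0 negb_or => /andP.
Qed.

Lemma cayley_unimod k : unimod (cayley k).
Proof.
have [h1 h2] := cayley_denominator k;
rewrite /unimod /cayley rmorphM /= fmorphV /= rmorphB rmorphD /=.
by rewrite rmorphM /= conjC1 conjC_nat conjCi mulrN opprK; field; rewrite h1 h2.
Qed.

Lemma cayley_inj : injective cayley.
Proof.
move=> a b; rewrite /cayley => e.
have [ha _] := cayley_denominator a; have [hb _] := cayley_denominator b.
have : (1 + a%:R * 'i) * (1 - b%:R * 'i) = (1 + b%:R * 'i) * (1 - a%:R * 'i) :> C.
  by move/eqP: e; rewrite eqr_div // => /eqP.
move=> h; have : 'i * 2 * a%:R = 'i * 2 * b%:R :> C.
  apply/eqP; rewrite -subr_eq0; apply/eqP.
  transitivity ((1 + a%:R * 'i) * (1 - b%:R * 'i) - (1 + b%:R * 'i) * (1 - a%:R * 'i) : C).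
    by ring.
  by rewrite h subrr.
have i2 : 'i * 2 != 0 :> C by rewrite mulf_eq0 negb_or neq0Ci pnatr_eq0.
by move/(mulfI i2)/eqP; rewrite eqr_nat => /eqP.
Qed.

(** Each pair in [s] excludes at most one unimodular [u], because [h] is injective in its scalar, so
    some Cayley number is left over. *)
Lemma unimod_avoid (I T : eqType) (h : I -> C -> T) (s : seq (I * T)) :
  (forall p u u', p \in s -> unimod u -> unimod u' -> h p.1 u = h p.1 u' -> u = u') ->
  exists2 u, unimod u & forall p, p \in s -> h p.1 u != p.2.
Proof.
(* Success for all large [k] is claimed, so that the induction can combine two bounds by their
   maximum. *)
move=> H; suff [N HN] : exists N, forall k, (N <= k)%N ->
    forall p, p \in s -> h p.1 (cayley k) != p.2.
  by exists (cayley N); [exact: cayley_unimod | exact: HN].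
elim: s H => [|p s IH] H; first by exists 0%N.
have [|N HN] := IH; first by move=> q u u' hq; apply: H; rewrite inE hq orbT.
case: (pselect (exists k, h p.1 (cayley k) = p.2)) => [[k0 e0]|ne].
  exists (maxn N k0.+1) => k; rewrite geq_max => /andP[hN hk] q.
  rewrite inE => /orP[/eqP->|hq]; last exact: HN.
  apply/eqP => e; have := H p _ _ (mem_head _ _) (cayley_unimod k) (cayley_unimod k0).
  by rewrite e e0 => /(_ erefl)/cayley_inj ek; rewrite ek ltnn in hk.
exists N => k hk q; rewrite inE => /orP[/eqP->|hq]; last exact: HN.
by apply/eqP => e; apply: ne; exists k.
Qed.

(** Rays are labelled by [proj], or by [proj] after an embedding; in the second case the rays to be
    avoided live in a larger space. *)
Definition faithful (D : finType) (T : eqType) (f : {ffun D -> C} -> T) :=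
  forall x y, ip x x = 1 -> ip y y = 1 -> f x = f y <-> same x y.

Lemma faithful_proj (D : finType) : faithful (@proj D).
Proof. by move=> x y hx hy; split; [exact: same_proj | exact: proj_same]. Qed.

Section Generic.
Variables (D I : finType) (T : eqType) (f : {ffun D -> C} -> T).
Hypothesis ff : faithful f.

Lemma refl_avoid (z : {ffun D -> C}) (q : I -> {ffun D -> C}) (B : seq T) :
  ip z z != 0 -> (forall i, ip (q i) (q i) = 1) ->
  exists2 u, unimod u & forall i, moved z (q i) -> f (refl z u (q i)) \notin B.
Proof.
move=> nz hq.
pose s := [seq (i, b) | i <- [seq i <- enum I | `[< moved z (q i) >]], b <- B].
have [|u hu H] := @unimod_avoid I T (fun i u => f (refl z u (q i))) s.
  move=> p u u' /allpairsP[[i b] /= [+ _ ->]] hu hu' /=.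
  rewrite mem_filter => /andP[/asboolP hm _].
  by move/ff; rewrite !(isom_refl _ nz).1 // => /(_ (hq i) (hq i))/(refl_inj nz hm).
exists u => // i hm; apply/negP => hB; have := H (i, f (refl z u (q i))).
rewrite eqxx => /(_ _)/negP; apply => //.
by apply/allpairsP; exists (i, f (refl z u (q i)));
rewrite mem_filter mem_enum; split=> //; rewrite andbT; apply/asboolP.
Qed.

Lemma same_unmoved (z x y : {ffun D -> C}) : same x y -> unmoved z y -> unmoved z x.
Proof.
case=> u _ -> [h|[c ->]]; first by left; rewrite ipZr h mulr0.
by right; exists (u * c); rewrite vscaleA.
Qed.

Lemma moved_same (z x y : {ffun D -> C}) : same x y -> moved z y -> moved z x.
Proof.
move=> e [h1 h2]; have [//|h] := unmovedP z x.
have [h3|[c h3]] := same_unmoved (same_sym e) h; last by case: (h2 c).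
by rewrite h3 eqxx in h1.
Qed.

(* U is a product of reflections in vectors of Z: each new generic reflection moves
   one more ray out of B and pushes none of the rays already moved back into B. *)
Lemma generic_isom (q : I -> {ffun D -> C}) (Z : {ffun D -> C} -> Prop)
    (fx : pred I) (B : seq T) :
  (forall i, ip (q i) (q i) = 1) -> (forall z, Z z -> ip z z != 0) ->
  (forall i z, fx i -> Z z -> unmoved z (q i)) ->
  (forall i, ~~ fx i -> exists2 z, Z z & moved z (q i)) ->
  exists U, [/\ isom U, forall i, fx i -> same (U (q i)) (q i)
             & forall i, ~~ fx i -> f (U (q i)) \notin B].
Proof.
(* The third invariant of the induction: every vector is still in its original ray or already
   outside [B]. *)
move=> hq hZ hfx hmv.
suff H (s : seq I) : exists U, [/\ isom U, forall i, fx i -> same (U (q i)) (q i),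
    forall i, same (U (q i)) (q i) \/ f (U (q i)) \notin B
    & forall i, i \in s -> ~~ fx i -> f (U (q i)) \notin B].
  have [U [h1 h2 _ h3]] := H (enum I); exists U; split=> // i; apply: h3.
  by rewrite mem_enum.
elim: s => [|i s [U [h1 h2 h3 h4]]].
  by exists id; split=> // [i _|i]; [|left]; exact: same_refl.
case: (boolP (~~ fx i && (f (U (q i)) \in B))) => [/andP[nf hB]|hn]; last first.
  exists U; split=> // j; rewrite inE => /orP[/eqP->|]; last exact: h4.
  by move: hn; case: (~~ fx i); case: (_ \in _).
(* By that invariant a label still in [B] belongs to a ray not moved so far, so the [z] that moves
   [q i] also moves [U (q i)]. *)
have hs : same (U (q i)) (q i) by case: (h3 i) => //; rewrite hB.
have [z Zz mz] := hmv i nf.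
have hUq j : ip (U (q j)) (U (q j)) = 1 by rewrite h1.1.
have [u hu H] := refl_avoid B (hZ z Zz) hUq.
have hr := isom_refl hu (hZ z Zz).
have U'1 := isom_comp hr h1.
have hU'q j : ip ((refl z u \o U) (q j)) ((refl z u \o U) (q j)) = 1.
  by rewrite U'1.1.
have st j : f ((refl z u \o U) (q j)) \notin B \/
    same ((refl z u \o U) (q j)) (U (q j)).
  have [hm|hm] := unmovedP z (U (q j)); first by left; exact: H.
  by right; exact: refl_unmoved (hZ z Zz) hm.
exists (refl z u \o U); split=> // [j fj|j|j].
- have := hfx _ _ fj Zz; move/(same_unmoved (h2 _ fj)).
  by move/(refl_unmoved hu (hZ z Zz))/same_trans; apply; exact: h2.
- case: (st j) => h; first by right.
  case: (h3 j) => h'; first by left; exact: same_trans h h'.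
  by right; move/ff: h => -> //; rewrite ?hU'q.
- rewrite inE => /orP[/eqP-> _|hj nj].
    by apply: H; exact: moved_same hs mz.
  case: (st j) => // h.
  by move/ff: h => -> //; exact: h4.
Qed.

End Generic.

(** * Counting the values of a finite family *)

Definition image_fset (I : finType) (T : choiceType) (g : I -> T) : {fset T} :=
  [fset g i | i in I]%fset.

Lemma image_fsetP (I : finType) (T : choiceType) (g : I -> T) t :
  reflect (exists i, t = g i) (t \in image_fset g).
Proof.
by apply: (iffP (imfsetP _ _ _ _)) => [[i _ ->]|[i ->]]; exists i.
Qed.

Lemma mem_image_fset (I : finType) (T : choiceType) (g : I -> T) i : g i \in image_fset g.
Proof. by apply/image_fsetP; exists i. Qed.

Lemma card_image_fset_le (I : finType) (T T' : choiceType) (g : I -> T) (g' : I -> T') :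
  (forall i j, g i = g j -> g' i = g' j) -> (#|` image_fset g'| <= #|` image_fset g|)%N.
Proof.
move=> H; case: (pickP I) => [i0 _|h0]; last first.
  suff -> : image_fset g' = fset0 by rewrite cardfs0.
  by apply/fsetP => t; rewrite inE; apply/image_fsetP => -[i _]; have := h0 i.
pose phi t := if [pick i | g i == t] is Some i then g' i else g' i0.
apply: leq_trans (leq_imfset_card imfset_key phi (mem (image_fset g))).
apply: fsubset_leq_card; apply/fsubsetP => t /image_fsetP[i ->].
apply/imfsetP; exists (g i); rewrite /= ?mem_image_fset // /phi.
by case: pickP => [j /eqP/H|/(_ i)]; rewrite ?eqxx.
Qed.

Lemma card_image_fset (I : finType) (T T' : choiceType) (g : I -> T) (g' : I -> T') :
  (forall i j, g i = g j <-> g' i = g' j) -> #|` image_fset g| = #|` image_fset g'|.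
Proof.
by move=> H; apply/eqP; rewrite eqn_leq !card_image_fset_le // => i j /H.
Qed.

Lemma card_image_fset_inj (I : finType) (T : choiceType) (g : I -> T) :
  injective g -> #|` image_fset g| = #|I|.
Proof. by move=> h; rewrite card_imfset //= -cardE. Qed.

(** * Quantum Latin squares over a finite index type, and moving them into generic position *)

Section Qls.
Variable D : finType.
Notation vec := {ffun D -> C}.

Definition qls (L : D -> D -> vec) :=
  (forall x y y', ip (L x y) (L x y') = (y == y')%:R) /\
  (forall y x x', ip (L x y) (L x' y) = (x == x')%:R).

Definition rays (L : D -> D -> vec) := image_fset (fun p : D * D => proj (L p.1 p.2)).

Lemma qls_unit L x y : qls L -> ip (L x y) (L x y) = 1.
Proof. by case=> h _; rewrite h eqxx. Qed.

Lemma delta_unit (k : D) : ip (delta k) (delta k) = 1.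
Proof. by rewrite ip_delta eqxx. Qed.

Lemma proj_delta_inj : injective (fun k : D => proj (delta k)).
Proof.
move=> k k' /same_proj; rewrite !delta_unit => /(_ erefl erefl)[u _ /ffunP/(_ k)].
rewrite !ffunE eqxx; case: eqP => // _; rewrite mulr0 => /eqP.
by rewrite oner_eq0.
Qed.

Lemma isom_qls U L : isom U -> qls L -> qls (fun x y => U (L x y)).
Proof. by case=> h _ [h1 h2]; split=> *; rewrite h. Qed.

(** Row [o] is the standard basis, so [r] counts the rays outside the basis, and it is known where
    each basis vector sits. *)
Definition has_qls (o : D) (r : nat) := exists Q, [/\ qls Q,
  forall d, Q o d = delta d & #|` rays Q| = (#|D| + r)%N].

(** A generic isometry keeps the basis rays outside [K] and sends all others off [B]: the [r]
    further rays and the |K| released basis rays become new. *)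
Lemma has_qls_move (T : choiceType) (f : vec -> T) o r (K : {set D}) (B : {fset T}) :
  faithful f -> has_qls o r -> #|K| != 1%N ->
  exists Q, [/\ qls Q, forall k, k \notin K -> same (Q o k) (delta k) &
    exists M : {fset T}, [/\ #|` M| = (r + #|K|)%N, [disjoint M & B]%fset &
      image_fset (fun p : D * D => f (Q p.1 p.2)) =
        (image_fset (fun k : {k | k \notin K} => f (delta (val k))) `|` M)%fset]].
Proof.
move=> ff [Q [hQ Qo cQ]] K1.
pose q (p : D * D) := Q p.1 p.2.
have uq p : ip (q p) (q p) = 1 by exact: qls_unit.
pose F := image_fset (fun k : {k | k \notin K} => f (delta (val k))).
pose fx (p : D * D) := f (q p) \in F.
(* Reflections in basis vectors move everything but the basis; those in
   e_k + e_k' with k, k' in K move the basis vectors indexed by K, which is why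
   K may not be a singleton. *)
pose Z (z : vec) := (exists k, z = delta k) \/
  exists k k', [/\ k \in K, k' \in K, k' != k & z = vadd (delta k) (delta k')].
have [|||U [U1 U2 U3]] :=
    @generic_isom D _ T f ff q Z fx (enum_fset (F `|` B)%fset) uq.
- move=> z [[k ->]|[k [k' [_ _ ne ->]]]]; first by rewrite delta_unit oner_eq0.
  rewrite !(ipDl, ipDr) !ip_delta !eqxx (negbTE ne) [k == k']eq_sym (negbTE ne).
  rewrite addr0 add0r.
  by rewrite -[1 + 1](natrD _ 1 1) pnatr_eq0.
- move=> p z /image_fsetP[[k nk] /= /(ff _ _ (uq p) (delta_unit k)) e] hz.
  apply: same_unmoved e _.
  case: hz => [[k1 ->]|[k1 [k2 [h1 h2 _ ->]]]].
    case: (eqVneq k1 k) => [->|ne]; first by right; exists 1; rewrite vscale1.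
    by left; rewrite ip_delta (negbTE ne).
  left; rewrite ipDl !ip_delta.
  by do 2![case: eqP => [ee|_]; first by rewrite -ee ?h1 ?h2 in nk]; rewrite addr0.
- move=> p nfx; have [k hk] : exists k, q p k != 0.
    case: (pselect (exists k, q p k != 0)) => // h; have := uq p.
    rewrite /ip big1 => [/esym/eqP|k _]; first by rewrite oner_eq0.
    case: (eqVneq (q p k) 0) => [->|hk]; first by rewrite mulr0.
    by case: h; exists k.
  have [hm|[hm|[c hc]]] := unmovedP (delta k) (q p).
  + by exists (delta k) => //; left; exists k.
  + by rewrite ip_deltal in hm; rewrite hm eqxx in hk.
  have hs : same (q p) (delta k) by apply: unit_par hc; rewrite ?delta_unit ?uq.
  have kK : k \in K.
    apply/negPn/negP => nk; case/negP: nfx; apply/image_fsetP; exists (exist _ k nk) => /=.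
    by apply/ff; rewrite ?uq ?delta_unit.
  have [k' k'K ne] : exists2 k', k' \in K & k' != k.
    have : (0 < #|K :\ k|)%N.
      by move: K1; rewrite (cardsD1 k) kK; case: #|_|.
    by case/card_gt0P => k'; rewrite !inE => /andP[ne hk']; exists k'.
  exists (vadd (delta k) (delta k')); first by right; exists k, k'.
  split.
    rewrite ipDl !ip_deltal hc !ffunE eqxx (negbTE ne) !mulr0 addr0 mulr1.
    by move: hk; rewrite hc !ffunE eqxx mulr1.
  move=> c' e; case/eqP: hk.
  have -> : q p k = q p k'.
    by rewrite e !ffunE !eqxx (negbTE ne) [k == k']eq_sym (negbTE ne) addr0 add0r.
  by rewrite hc !ffunE (negbTE ne) mulr0.
have uUq p : ip (U (q p)) (U (q p)) = 1 by rewrite U1.1.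
have hF k : k \notin K -> f (q (o, k)) \in F /\ q (o, k) = delta k.
  by move=> nk; rewrite /q /= Qo; split=> //; apply/image_fsetP; exists (exist _ k nk).
exists (fun x y => U (Q x y)); split; first exact: isom_qls.
  by move=> k /hF[h e]; rewrite -e; exact: (U2 (o, k)).
have sub : (F `<=` image_fset (fun p => f (U (q p))))%fset.
  apply/fsubsetP => t /image_fsetP[[k nk] /= ->]; have [h e] := hF _ nk.
  apply/image_fsetP; exists (o, k); apply/esym/ff; rewrite ?delta_unit ?uUq //.
  by rewrite -e; exact: U2.
exists (image_fset (fun p => f (U (q p))) `\` F)%fset; split; last first.
- apply/fsetP => t; rewrite -/F in_fsetU in_fsetD.
  by case: (boolP (t \in F)) => //= /(fsubsetP sub) ->.
- apply/fdisjointP => t; rewrite inE => /andP[nF /image_fsetP[p e]].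
  have [fp|nfp] := boolP (fx p).
    case/negP: nF; rewrite e; suff -> : f (U (q p)) = f (q p) by [].
    by apply/ff; rewrite ?uUq ?uq //; exact: U2.
  by have := U3 p nfp; rewrite -e inE negb_or => /andP[].
(* The new rays are counted by subtraction: an isometry preserves the total |D| + r, and |D| - |K|
   basis rays stay. *)
have cF : #|` F| = (#|D| - #|K|)%N.
  rewrite card_image_fset_inj.
    rewrite card_sig -(cardsC K) addKn -[RHS]cardsE.
    by apply: eq_card => k; rewrite !inE.
  move=> [k nk] [k' nk'] /= /ff; rewrite !delta_unit => /(_ erefl erefl)/proj_same.
  by move/proj_delta_inj => e; apply: val_inj.
have cU : #|` image_fset (fun p => f (U (q p)))| = (#|D| + r)%N.
  rewrite -cQ; apply: card_image_fset => i j; split=> [/ff|/same_proj].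
    by rewrite !uUq => /(_ erefl erefl)/(isom_same_inv U1 (uq i) (uq j))/proj_same.
  by rewrite !qls_unit // => /(_ erefl erefl)/(isom_same U1) h; apply/ff; rewrite ?uUq.
rewrite cardfsD (fsetIidPr sub) cU cF; have := max_card (mem K).
by move=> h; rewrite subnBA // addnAC -addnA addKn addnC.
Qed.

End Qls.

End Vectors.

(** * Gluing squares *)

Section Embedding.
Variables (C : numClosedFieldType) (D X : finType).
Variables (f : D -> X) (g : X -> option D).
Hypotheses (fK : forall d, g (f d) = Some d) (gK : forall x d, g x = Some d -> f d = x).

Definition emb (v : {ffun D -> C}) : {ffun X -> C} :=
  [ffun x => if g x is Some d then v d else 0].

Lemma emb_f v d : emb v (f d) = v d.
Proof. by rewrite ffunE fK. Qed.

Lemma ip_emb v w : ip (emb v) (emb w) = ip v w.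
Proof.
rewrite /ip (bigID (fun x => g x != None)) /= [X in _ + X]big1 => [|x]; last first.
  by rewrite !ffunE; case: (g x) => //; rewrite mulr0.
rewrite (reindex_omap f g) => [|x]; last by case e : (g x) => [d|//] _ /=; rewrite (gK e).
rewrite addr0; apply: eq_big => [d|d _]; first by rewrite fK eqxx.
by rewrite !emb_f.
Qed.

Lemma emb_delta d : emb (delta C d) = delta C (f d).
Proof.
apply/ffunP => x; rewrite !ffunE; case e : (g x) => [d'|].
  rewrite ffunE -(gK e); suff -> : (f d' == f d) = (d' == d) by [].
  by apply/eqP/eqP => [/(congr1 g)|->//]; rewrite !fK => -[].
by case: eqP => // ex; rewrite ex fK in e.
Qed.

Lemma emb_same v w : same (emb v) (emb w) <-> same v w.
Proof.
split=> [[u hu e]|[u hu ->]]; exists u => //.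
  by apply/ffunP => d; rewrite ffunE -!emb_f e ffunE.
by apply/ffunP => x; rewrite !ffunE; case: (g x) => [d|]; rewrite ?ffunE ?mulr0.
Qed.

Lemma faithful_emb : faithful (fun v => proj (emb v)).
Proof.
move=> v w hv hw; rewrite -emb_same; split; last exact: proj_same.
by apply: same_proj; rewrite ip_emb.
Qed.

End Embedding.

Section Glue.
Variables (C : numClosedFieldType) (X P : finType).
Variables (pc : X -> X -> P) (sup : X -> X -> X -> Prop).
Notation vec := {ffun X -> C}.
Notation T := {ffun X * X -> C}.
Hypothesis supr : forall x y y' z, pc x y <> pc x y' -> sup x y z -> sup x y' z -> False.
Hypothesis supc : forall y x x' z, pc x y <> pc x' y -> sup x y z -> sup x' y z -> False.

(** [pc] cuts the array into pieces. Orthogonality is demanded within a piece only; between pieces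
    of one row or column it follows from the disjoint supports in [supr] and [supc]. *)
Definition valid (p : P) (W : X -> X -> vec) := [/\
  forall x y z, pc x y = p -> W x y z != 0 -> sup x y z,
  forall x y y', pc x y = p -> pc x y' = p -> ip (W x y) (W x y') = (y == y')%:R
  & forall y x x', pc x y = p -> pc x' y = p -> ip (W x y) (W x' y) = (x == x')%:R].

(** [c] holds the rays common to all pieces, [core] the part of [c] that piece [p] must display, and
    [M] its own new rays. *)
Definition fills (p : P) (c core M : {fset T}) W := [/\ valid p W,
  forall x y, pc x y = p -> proj (W x y) \in (c `|` M)%fset,
  forall t, t \in core -> exists x y, pc x y = p /\ t = proj (W x y)
  & forall t, t \in M -> exists x y, pc x y = p /\ t = proj (W x y)].

Definition fillable (p : P) (c core : {fset T}) (mu : nat) := forall B : {fset T},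
  exists W (M : {fset T}), [/\ #|` M| = mu, [disjoint M & B]%fset & fills p c core M W].

Lemma disj_sup (x y x' y' : X) (v w : vec) :
  (forall z, v z != 0 -> sup x y z) -> (forall z, w z != 0 -> sup x' y' z) ->
  (forall z, sup x y z -> sup x' y' z -> False) -> ip v w = 0.
Proof.
move=> hv hw h; rewrite /ip big1 // => z _.
have [->|nv] := eqVneq (v z) 0; first by rewrite conjC0 mul0r.
have [->|nw] := eqVneq (w z) 0; first by rewrite mulr0.
by case: (h z); [exact: hv | exact: hw].
Qed.

Lemma glue_qls (W : P -> X -> X -> vec) :
  (forall p, valid p (W p)) -> qls (fun x y => W (pc x y) x y).
Proof.
move=> hW; split=> [x y y'|y x x'].
  have [e|ne] := eqVneq (pc x y) (pc x y').
    by have [_ h _] := hW (pc x y); rewrite -e h.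
  have -> : (y == y') = false by apply/negbTE; apply: contra ne => /eqP->.
  apply: (@disj_sup x y x y') => z.
  - by have [h _ _] := hW (pc x y); exact: h.
  - by have [h _ _] := hW (pc x y'); exact: h.
  - by apply: supr; apply/eqP.
have [e|ne] := eqVneq (pc x y) (pc x' y).
  by have [_ _ h] := hW (pc x y); rewrite -e h.
have -> : (x == x') = false by apply/negbTE; apply: contra ne => /eqP->.
apply: (@disj_sup x y x' y) => z.
- by have [h _ _] := hW (pc x y); exact: h.
- by have [h _ _] := hW (pc x' y); exact: h.
- by apply: supc; apply/eqP.
Qed.

(** The pieces are filled one after the other, each avoiding [c] and the new rays of its
    predecessors, so the numbers of new rays add up. *)
Lemma glue_count (c : {fset T}) (core : P -> {fset T}) (mu : P -> nat) :
  (forall p, fillable p c (core p) (mu p)) ->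
  (forall t, t \in c -> exists p, t \in core p) ->
  exists L : X -> X -> vec, qls L /\ #|` rays L| = (#|` c| + \sum_p mu p)%N.
Proof.
move=> hf hc.
have [Wf [Mf [H1 H2]]] : exists (Wf : P -> X -> X -> vec) (Mf : P -> {fset T}),
    (forall p, p \in enum P -> fills p c (core p) (Mf p) (Wf p)) /\
    #|` (c `|` \bigcup_(p <- enum P) Mf p)%fset| = (#|` c| + \sum_(p <- enum P) mu p)%N.
  elim: (enum P) (enum_uniq P) => [_|p s IH /= /andP[ps /IH[Wf [Mf [H1 H2]]]]].
    exists (fun _ _ _ => 0), (fun=> fset0); split=> //.
    by rewrite !big_nil fsetU0 addn0.
  have [W [M [cM dM fM]]] := hf p (c `|` \bigcup_(p <- s) Mf p)%fset.
  exists (fun q => if q == p then W else Wf q), (fun q => if q == p then M else Mf q).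
  split=> [q|]; first by rewrite inE; case: eqP => [-> _|_ /= /H1].
  have -> : (\bigcup_(q <- p :: s) (if q == p then M else Mf q))%fset =
      (M `|` \bigcup_(q <- s) Mf q)%fset.
    rewrite big_cons eqxx; congr (_ `|` _)%fset.
    by apply: eq_big_seq => q qs; case: eqP => // e; rewrite -e qs in ps.
  rewrite fsetUCA cardfsU (eqP (_ : (M `&` _)%fset == fset0)) ?cardfs0 ?subn0; last first.
    by move: dM; rewrite -fsetI_eq0.
  by rewrite H2 cM big_cons addnCA.
exists (fun x y => Wf (pc x y) x y); split.
  by apply: glue_qls => p; have [] := H1 p (mem_enum _ _).
rewrite -[in RHS]big_enum -H2; congr #|` _|; apply/fsetP => t; apply/idP/idP.
  move=> /image_fsetP[[x y] /= ->]; have [_ h _ _] := H1 (pc x y) (mem_enum _ _).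
  have := h x y erefl; rewrite !in_fsetU => /orP[->//|h']; apply/orP; right.
  by apply/bigfcupP; exists (pc x y) => //; rewrite mem_enum.
rewrite in_fsetU => /orP[/hc[p hp]|/bigfcupP[p _ hp]].
  have [_ _ h _] := H1 p (mem_enum _ _); have [x [y [e ->]]] := h t hp.
  by apply/image_fsetP; exists (x, y); rewrite /= e.
have [_ _ _ h] := H1 p (mem_enum _ _); have [x [y [e ->]]] := h t hp.
by apply/image_fsetP; exists (x, y); rewrite /= e.
Qed.

End Glue.

(* By transport and a change of basis, any square of order d with d + r rays
   has this property. *)
Definition extends_basis (C : numClosedFieldType) (d r : nat) :=
  forall (D : finType) (o : D), #|D| = d -> has_qls C o r.

(** * Blowing up a Latin square *)

Section Product.
Variables (C : numClosedFieldType) (n m s : nat).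
Variables (A T : 'I_n -> 'I_n -> 'I_n) (cf rf : 'I_n -> 'I_s -> 'I_n).
Hypotheses (A_row : forall a, injective (A a)) (A_col : forall b, injective (A^~ b)).
Hypothesis AT_inj : forall a b a' b', A a b = A a' b' -> T a b = T a' b' -> a = a' /\ b = b'.
Hypothesis AT_surj : forall l t, exists a b, A a b = l /\ T a b = t.
Hypotheses (cfT : forall a t, T a (cf a t) = t :> nat) (rfT : forall b t, T (rf b t) b = t :> nat).
Hypothesis cfU : forall a b (t : 'I_s), T a b = t :> nat -> b = cf a t.
Hypothesis rfU : forall a b (t : 'I_s), T a b = t :> nat -> a = rf b t.
Hypotheses (sn : (s < n)%N) (m_gt0 : (0 < m)%N).

(* The cells with T = t < s form the t-th transversal, cf and rf list its columns and
   rows; the blocks with T = n - 1 keep the standard basis. *)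
Notation X := ('I_n * 'I_m + 'I_s)%type.
Notation P := (option ('I_n * 'I_n)).

(** A block on transversal [t] is bordered by row and column [t] of the hole. Its corner would be
    the cell (t, t), which belongs to the hole piece [None]. *)
Definition pcell (x y : X) : P :=
  match x, y with
  | inl (a, _), inl (b, _) => Some (a, b)
  | inl (a, _), inr t => Some (a, cf a t)
  | inr t, inl (b, _) => Some (rf b t, b)
  | inr _, inr _ => None
  end.

(* psup x y z: the entry of cell (x, y) may have a nonzero coordinate z. *)
Definition psup (x y z : X) : Prop :=
  match x, y, z with
  | inl (a, _), inl (b, _), inl (l, _) => l = A a b
  | inl (a, _), inl (b, _), inr t => T a b = t :> nat
  | inl (a, _), inr t, inl (l, _) => l = A a (cf a t)
  | inr t, inl (b, _), inl (l, _) => l = A (rf b t) b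
  | inr _, inr _, inr _ => True
  | _, _, _ => False
  end.

(** Blocks in one row carry different symbols, and only one of them lies on a given transversal. In
    a row of the hole the blocks are cells of one transversal, whose symbols differ by orthogonality
    of [A] and [T]. *)
Lemma psupr x y y' z : pcell x y <> pcell x y' -> psup x y z -> psup x y' z -> False.
Proof.
case: x y y' z => [[a i]|t] [[b j]|u] [[b' j']|u'] [[l k]|w] //= ne.
- by move=> -> /A_row e; apply: ne; rewrite e.
- by move=> /cfU e1 /cfU e2; apply: ne; rewrite e1 e2.
- by move=> -> /A_row e; apply: ne; rewrite e.
- by move=> -> /A_row e; apply: ne; rewrite e.
- by move=> -> /A_row e; apply: ne; rewrite e.
- move=> -> /AT_inj; case; first by apply: val_inj; rewrite /= !rfT.
  by move=> e1 e2; apply: ne; rewrite e1 e2.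
Qed.

Lemma psupc y x x' z : pcell x y <> pcell x' y -> psup x y z -> psup x' y z -> False.
Proof.
case: y x x' z => [[b j]|t] [[a i]|u] [[a' i']|u'] [[l k]|w] //= ne.
- by move=> -> /A_col e; apply: ne; rewrite e.
- by move=> /rfU e1 /rfU e2; apply: ne; rewrite e1 e2.
- by move=> -> /A_col e; apply: ne; rewrite e.
- by move=> -> /A_col e; apply: ne; rewrite e.
- by move=> -> /A_col e; apply: ne; rewrite e.
- move=> -> /AT_inj; case; first by apply: val_inj; rewrite /= !cfT.
  by move=> e1 _; apply: ne; rewrite e1.
Qed.

Definition base_rays : {fset {ffun X * X -> C}} := image_fset (fun x : X => proj (delta C x)).

Definition pcore (p : P) : {fset {ffun X * X -> C}} :=
  match p with
  | None => image_fset (fun t : 'I_s => proj (delta C (inr t : X)))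
  | Some (a, b) => if (T a b == n.-1 :> nat)
      then image_fset (fun k : 'I_m => proj (delta C (inl (A a b, k) : X))) else fset0
  end.

(** Local coordinates with their partial inverses: [fL] for a plain block with symbol [l], [fT] for
    a block on transversal [t], where [None] is the coordinate shared with the hole, and [fH] for
    the hole. *)
Definition fL (l : 'I_n) (i : 'I_m) : X := inl (l, i).
Definition gL (l : 'I_n) (x : X) : option 'I_m :=
  if x is inl (l', i) then if l' == l then Some i else None else None.
Lemma fLK l d : gL l (fL l d) = Some d.
Proof. by rewrite /= eqxx. Qed.
Lemma gLK l x d : gL l x = Some d -> fL l d = x.
Proof. by case: x => [[l' i]|t] //=; case: eqP => // -> [->]. Qed.

Definition fT (l : 'I_n) (t : 'I_s) (i : option 'I_m) : X :=
  if i is Some i then inl (l, i) else inr t.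
Definition gT (l : 'I_n) (t : 'I_s) (x : X) : option (option 'I_m) :=
  match x with
  | inl (l', i) => if l' == l then Some (Some i) else None
  | inr t' => if t' == t then Some None else None
  end.
Lemma fTK l t d : gT l t (fT l t d) = Some d.
Proof. by case: d => [d|] /=; rewrite eqxx. Qed.
Lemma gTK l t x d : gT l t x = Some d -> fT l t d = x.
Proof. by case: x => [[l' i]|t'] /=; case: eqP => // -> [<-]. Qed.

Definition fH (t : 'I_s) : X := inr t.
Definition gH (x : X) : option 'I_s := if x is inr t then Some t else None.
Lemma fHK d : gH (fH d) = Some d. Proof. by []. Qed.
Lemma gHK x d : gH x = Some d -> fH d = x.
Proof. by case: x => [[]|t] //= [->]. Qed.

(** The square in block (a, b) has [r a b] rays besides the basis, and [k a b] of its basis rays are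
    released. By [hkc] the blocks that must show the basis release none. *)
Variables (r k : 'I_n -> 'I_n -> nat) (r0 : nat).
Hypothesis hr : forall a b, extends_basis C (if (T a b < s)%N then m.+1 else m) (r a b).
Hypothesis hr0 : extends_basis C s r0.
Hypothesis hr00 : s = 0%N -> r0 = 0%N.
Hypothesis hk : forall a b, (k a b <= m)%N && (k a b != 1%N).
Hypothesis hkc : forall a b, T a b = n.-1 :> nat -> k a b = 0%N.

Lemma card_lt_ord (j : nat) : (j <= m)%N -> #|[set i : 'I_m | (i < j)%N]| = j.
Proof.
move=> jm; rewrite -sum1_card (eq_bigl (fun i : 'I_m => (i < j)%N)); last first.
  by move=> i; rewrite inE.
by rewrite (big_ord_narrow jm) sum1_card card_ord.
Qed.

Lemma mem_base_rays x : proj (delta C x) \in base_rays.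
Proof. exact: mem_image_fset. Qed.

Lemma fill_block a b : (s <= T a b)%N ->
  fillable pcell psup (Some (a, b)) base_rays (pcore (Some (a, b))) (r a b + k a b).
Proof.
move=> sT B; set l := A a b.
have := @hr a b; rewrite ltnNge sT /= => /(_ _ (Ordinal m_gt0) (card_ord m)) hq.
have /andP[km k1] := hk a b.
pose K := [set i : 'I_m | (i < k a b)%N].
have cK : #|K| = k a b by rewrite card_lt_ord.
have [|Q [hQ Q0 [M [cM dM eM]]]] := has_qls_move (K := K) (B `|` base_rays)%fset
  (faithful_emb (@fLK l) (@gLK l)) hq; first by rewrite cK.
(* Outside the block [delta C x] is a mere placeholder. *)
exists (fun x y => if x is inl (_, i) then if y is inl (_, j) then emb (gL l) (Q i j)
  else delta C x else delta C x), M; split.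
- by rewrite cM cK.
- by move: dM; rewrite fdisjointXU => /andP[].
have nT c t : Some (c, cf c t) <> Some (a, b).
  by move=> [e1 e]; have := cfT c t; rewrite e e1 => e2; move: sT; rewrite e2 leqNgt ltn_ord.
have nT' c t : Some (rf c t, c) <> Some (a, b).
  by move=> [e e1]; have := rfT c t; rewrite e e1 => e2; move: sT; rewrite e2 leqNgt ltn_ord.
split.
- split.
  + move=> [[a' i]|t] [[b' j]|t'] z //=; try by [move/nT|move/nT'].
    move=> [-> ->]; case: z => [[l' u]|u] /=; last by rewrite ffunE eqxx.
    rewrite ffunE /=; case: (eqVneq l' l) => [->|_] //; by rewrite eqxx.
  + move=> [[a' i]|t] [[b' j]|t'] [[b'' j']|t''] //=; try by [move/nT|move/nT'| move=> _ /nT].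
    move=> [-> ->] [->]; rewrite (ip_emb (@fLK l) (@gLK l)) hQ.1.
    by congr (_%:R); rewrite /eq_op /= /eq_op /= eqxx.
  + move=> [[b' j]|t] [[a' i]|t'] [[a'' i']|t''] //=; try by [move/nT|move/nT'| move=> _ /nT'].
    move=> [-> ->] [->]; rewrite (ip_emb (@fLK l) (@gLK l)) hQ.2.
    by congr (_%:R); rewrite /eq_op /= /eq_op /= eqxx.
- move=> [[a' i]|t] [[b' j]|t'] //=; try by [move/nT|move/nT'].
  move=> _; have := mem_image_fset (fun p : 'I_m * 'I_m => proj (emb (gL l) (Q p.1 p.2))) (i, j).
  rewrite eM !in_fsetU => /orP[/image_fsetP[[k' nk] /= ->]|->]; last by rewrite orbT.
  by rewrite (emb_delta _ (@fLK l) (@gLK l)) mem_base_rays.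
- move=> t /=; case: eqP => // eT /image_fsetP[k' ->].
  exists (inl (a, Ordinal m_gt0)), (inl (b, k')); split=> //.
  rewrite -(emb_delta C (@fLK l) (@gLK l)); apply/esym/proj_same.
  apply/(emb_same (@fLK l)); apply: Q0.
  (* Here [K] is empty, so the first row of the block shows the basis vectors of its symbol. *)
  by rewrite inE hkc // ltn0.
- move=> t tM; have : t \in image_fset (fun p : 'I_m * 'I_m => proj (emb (gL l) (Q p.1 p.2))).
    by rewrite eM in_fsetU tM orbT.
  by case/image_fsetP => -[i j] /= ->; exists (inl (a, i)), (inl (b, j)).
Qed.

Lemma fill_trans a b (t : 'I_s) : T a b = t :> nat ->
  fillable pcell psup (Some (a, b)) base_rays (pcore (Some (a, b))) (r a b + k a b).
Proof.
move=> eT B; set l := A a b.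
have eb := cfU eT; have ea := rfU eT.
have := @hr a b; rewrite eT ltn_ord => /(_ (option 'I_m : finType) None).
rewrite card_option card_ord => /(_ erefl) hq.
have /andP[km k1] := hk a b.
(* The coordinate [None] is never released, so the corner entry stays a basis ray. *)
pose K := [set Some i | i in [set i : 'I_m | (i < k a b)%N]].
have cK : #|K| = k a b by rewrite card_imset ?card_lt_ord //; exact: Some_inj.
have [|Q [hQ Q0 [M [cM dM eM]]]] := has_qls_move (K := K) (B `|` base_rays)%fset
  (faithful_emb (@fTK l t) (@gTK l t)) hq; first by rewrite cK.
pose loc (x : X) := if x is inl (_, i) then Some i else None.
have Q00 : same (Q None None) (delta C None).
  by apply: Q0; apply/negP => /imsetP[].
(* Orthogonality to the corner entry kills the hole coordinate in the border cells, so they do not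
   interfere with the square in the hole. *)
have Qr i : Q (Some i) None None = 0.
  have := hQ.2 None None (Some i); case: Q00 => u hu ->.
  rewrite ipZl ip_deltal => /eqP; rewrite mulf_eq0 => /orP[|/eqP//].
  by rewrite conjC_eq0 (negbTE (unimod_neq0 hu)).
have Qc i : Q None (Some i) None = 0.
  have := hQ.1 None None (Some i); case: Q00 => u hu ->.
  rewrite ipZl ip_deltal => /eqP; rewrite mulf_eq0 => /orP[|/eqP//].
  by rewrite conjC_eq0 (negbTE (unimod_neq0 hu)).
have h1 c t' : Some (c, cf c t') = Some (a, b) -> t' = t.
  by move=> [e1 e]; have := cfT c t'; rewrite e e1 eT => e2; apply: val_inj.
have h2 c t' : Some (rf c t', c) = Some (a, b) -> t' = t.
  by move=> [e e1]; have := rfT c t'; rewrite e e1 eT => e2; apply: val_inj.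
exists (fun x y => emb (gT l t) (Q (loc x) (loc y))), M; split.
- by rewrite cM cK.
- by move: dM; rewrite fdisjointXU => /andP[].
split.
- split.
  + move=> [[a' i]|u] [[b' j]|u'] z //=.
    * move=> [-> ->]; case: z => [[l' w]|w] /=; rewrite ffunE /=.
        by case: (eqVneq l' l) => [->|_] //; rewrite eqxx.
      by case: (eqVneq w t) => [->|_] //; rewrite eqxx.
    * move=> e; have -> := h1 _ _ e; case: e => -> _.
      case: z => [[l' w]|w] /=; rewrite ffunE /=.
        by case: (eqVneq l' l) => [->|_]; rewrite -?eb ?eqxx.
      by case: (w == t); rewrite ?Qr eqxx.
    * move=> e; have -> := h2 _ _ e; case: e => _ ->.
      case: z => [[l' w]|w] /=; rewrite ffunE /=.
        by case: (eqVneq l' l) => [->|_]; rewrite -?ea ?eqxx.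
      by case: (w == t); rewrite ?Qc eqxx.
  + move=> x y y' e e'; rewrite (ip_emb (@fTK l t) (@gTK l t)) hQ.1.
    suff -> : (loc y == loc y') = (y == y') by [].
    apply/eqP/eqP => [|->//]; move: x y y' e e'.
    move=> [[a' i]|u] [[b' j]|u'] [[b'' j']|u''] //=.
    * by move=> [_ ->] [_ ->] [->].
    * by move=> /h1-> /h1->.
    * by move=> [_ ->] [_ ->] [->].
  + move=> y x x' e e'; rewrite (ip_emb (@fTK l t) (@gTK l t)) hQ.2.
    suff -> : (loc x == loc x') = (x == x') by [].
    apply/eqP/eqP => [|->//]; move: y x x' e e'.
    move=> [[b' i]|u] [[a' j]|u'] [[a'' j']|u''] //=.
    * by move=> [-> _] [-> _] [->].
    * by move=> /h2-> /h2->.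
    * by move=> [-> _] [-> _] [->].
- move=> x y _.
  have := mem_image_fset (fun p => proj (emb (gT l t) (Q p.1 p.2))) (loc x, loc y).
  rewrite eM !in_fsetU => /orP[/image_fsetP[[k' nk] /= ->]|->]; last by rewrite orbT.
  by rewrite (emb_delta _ (@fTK l t) (@gTK l t)) mem_base_rays.
(* A transversal block has T < s <= n - 1, hence an empty core. *)
- move=> t' /=; case: eqP => // e; exfalso; move: eT (ltn_ord t); rewrite e => <-.
  by rewrite ltnNge -ltnS prednK // (leq_trans _ sn).
- move=> t' tM; have : t' \in image_fset (fun p => proj (emb (gT l t) (Q p.1 p.2))).
    by rewrite eM in_fsetU tM orbT.
  case/image_fsetP => -[[i|] [j|]] /= e.
  + by exists (inl (a, i)), (inl (b, j)).
  + by exists (inl (a, i)), (inr t); rewrite /= -eb.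
  + by exists (inr t), (inl (b, j)); rewrite /= -ea.
  (* The corner is not a cell of this piece, but it holds a basis ray and [M] avoids these. *)
  + move: dM; rewrite fdisjointXU => /andP[_ /fdisjointP/(_ _ tM)/negP[]].
    rewrite e; have /(emb_same (@fTK l t)) h := Q00; rewrite (proj_same h).
    by rewrite (emb_delta _ (@fTK l t) (@gTK l t)) mem_base_rays.
Qed.

Lemma fill_hole : fillable pcell psup None base_rays (pcore None) r0.
Proof.
move=> B; case: (posnP s) => [s0|s_gt0].
  exists (fun x y => delta C x), fset0; split.
  - by rewrite cardfs0 hr00.
  - exact: fdisjoint0X.
  have noS (t : 'I_s) : False by case: t => i; rewrite s0.
  split=> [|x y|t /image_fsetP[u]|t]; last by rewrite in_fset0.
  - by split=> [x y z|x y y'|y x x'] //; move: x y => [[a i]|t] [[b j]|u] //; case: (noS t).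
  - by case: x y => [[a i]|t] [[b j]|u] //; case: (noS t).
  - by case: (noS u).
have hq := @hr0 _ (Ordinal s_gt0) (card_ord s).
have [|Q [hQ Q0 [M [cM dM eM]]]] := has_qls_move (K := set0) (B `|` base_rays)%fset
  (faithful_emb fHK gHK) hq; first by rewrite cards0.
exists (fun x y => if x is inr t then if y is inr u then emb gH (Q t u)
  else delta C x else delta C x), M; split.
- by rewrite cM cards0 addn0.
- by move: dM; rewrite fdisjointXU => /andP[].
split.
- split.
  + move=> [[a' i]|t] [[b' j]|t'] z //= _; case: z => [[l' u]|u] //=.
    by rewrite ffunE /= eqxx.
  + move=> [[a' i]|t] [[b' j]|t'] [[b'' j']|t''] //= _ _.
    by rewrite (ip_emb fHK gHK) hQ.1.
  + move=> [[a' i]|t] [[b' j]|t'] [[b'' j']|t''] //= _ _.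
    by rewrite (ip_emb fHK gHK) hQ.2.
- move=> [[a' i]|t] [[b' j]|u] //= _.
  have := mem_image_fset (fun p : 'I_s * 'I_s => proj (emb gH (Q p.1 p.2))) (t, u).
  rewrite eM !in_fsetU => /orP[/image_fsetP[[k' nk] /= ->]|->]; last by rewrite orbT.
  by rewrite (emb_delta _ fHK gHK) mem_base_rays.
- move=> t' /image_fsetP[t ->]; exists (inr (Ordinal s_gt0)), (inr t); split=> //.
  rewrite -(emb_delta C fHK gHK); apply/esym/proj_same.
  by apply/(emb_same fHK); apply: Q0; rewrite inE.
- move=> t tM; have : t \in image_fset (fun p : 'I_s * 'I_s => proj (emb gH (Q p.1 p.2))).
    by rewrite eM in_fsetU tM orbT.
  by case/image_fsetP => -[i j] /= ->; exists (inr i), (inr j).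
Qed.

Lemma product_qls : exists L : X -> X -> {ffun X -> C}, qls L /\
  #|` rays L| = (n * m + s + (\sum_a \sum_b (r a b + k a b) + r0))%N.
Proof.
pose mu (p : P) := if p is Some (a, b) then (r a b + k a b)%N else r0.
have [||L [qL cL]] := glue_count psupr psupc (c := base_rays) (core := pcore) (mu := mu).
- move=> [[a b]|]; last exact: fill_hole.
  by case: (leqP s (T a b)) => h; [exact: fill_block | exact: (@fill_trans a b (Ordinal h))].
- move=> t /image_fsetP[[[l i]|u] ->]; last by exists None; apply/image_fsetP; exists u.
  have n1 : (n.-1 < n)%N by rewrite prednK // (leq_trans _ sn).
  have [a [b [eA eT]]] := AT_surj l (Ordinal n1).
  by exists (Some (a, b)); rewrite /= eT eqxx; apply/image_fsetP; exists i; rewrite eA.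
exists L; split=> //; rewrite cL card_image_fset_inj; last exact: proj_delta_inj.
rewrite card_sum card_prod !card_ord; congr (_ + _)%N.
rewrite (bigD1 None) //= addnC; congr (_ + _)%N.
rewrite (reindex_omap Some id) => [|[]] //=; rewrite pair_bigA /=.
by apply: eq_big => [p|[a b]] //; rewrite eqxx.
Qed.

End Product.

(** * From arrays over a finite type to matrices of complex column vectors *)

Section ToArray.
Variable R : realType.
Notation C := R[i].

Lemma unimod_expi (u : C) :
  unimod u <-> exists theta : R, 0 <= theta < 2 * pi /\ u = expi theta.
Proof.
split=> [|[t [_ ->]]]; last first.
  apply/eqP; rewrite eq_complex /= mulNr opprK -!expr2 cos2Dsin2 eqxx /=.
  by rewrite mulNr mulrC addrN.
case: u => a b; rewrite /unimod => /eqP; rewrite eq_complex /=.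
rewrite mulNr opprK -!expr2 => /andP[/eqP h _].
have a1 : -1 <= a <= 1.
  rewrite -ler_norml -(@ler_pXn2r _ 2) ?nnegrE // expr1n real_normK ?num_real //.
  by rewrite -h lerDl sqr_ge0.
have pi0 : 0 < pi :> R by exact: pi_gt0.
have hs : sin (acos a) = `|b|.
  by rewrite sin_acos // -h addrAC subrr add0r sqrtr_sqr.
have [b0|b0] := leP 0 b.
  exists (acos a); rewrite acos_ge0 //= /expi acosK // hs ger0_norm //; split=> //.
  by apply: le_lt_trans (acos_lepi a1) _; rewrite mulr_natl mulr2n ltrDl.
(* For b < 0 the angle lies in the lower half plane; [acos a] is nonzero, which keeps the angle
   strictly below 2 pi. *)
exists (2 * pi - acos a); split.
  have := acos_lepi a1; have := acos_ge0 a1; move=> h0 h1.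
  have h2 : acos a != 0.
    by apply/eqP => e; move: hs; rewrite e sin0 => /esym/eqP; rewrite normr_eq0 (lt_eqF b0).
  have h3 : 0 < acos a by rewrite lt_neqAle eq_sym h2.
  by apply/andP; split; [lra | lra].
have e2 : 2 * pi = pi *+ 2 :> R by rewrite mulr_natl.
have -> : 2 * pi - acos a = - acos a + pi *+ 2 by rewrite e2 addrC.
rewrite /expi (cosD (- acos a)) (sinD (- acos a)) cos2pi sin2pi.
rewrite !mulr1 !mulr0 subr0 addr0 cosN sinN acosK //.
by rewrite hs ltr0_norm // opprK.
Qed.

Lemma phase_eqP v (x y : 'cV[C]_v) :
  phase_eq x y <-> same [ffun k => x k 0] [ffun k => y k 0].
Proof.
split=> [[t [ht e]]|[u /unimod_expi[t [ht ->]] /ffunP e]].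
  exists (expi t); first by apply/unimod_expi; exists t.
  by apply/ffunP => k; rewrite !ffunE e mxE.
by exists t; split=> //; apply/matrixP => k j; rewrite ord1 mxE; have := e k; rewrite !ffunE.
Qed.

Lemma braketE v (x y : 'cV[C]_v) :
  braket x y = ip [ffun k => x k 0] [ffun k => y k 0].
Proof. by apply: eq_bigr => k _; rewrite !ffunE. Qed.

Lemma braket_sumr v (x : 'cV[C]_v) n (k : 'I_n -> C) (b : 'I_n -> 'cV[C]_v) :
  braket x (\sum_i k i *: b i) = \sum_i k i * braket x (b i).
Proof.
rewrite /braket; under [RHS]eq_bigr => i _ do rewrite mulr_sumr.
rewrite exchange_big /=; apply: eq_bigr => d _; rewrite summxE mulr_sumr.
by apply: eq_bigr => i _; rewrite mxE mulrCA.
Qed.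

Lemma orthonormal_is_basis v (b : v.-tuple 'cV[C]_v) :
  (forall i j, braket (tnth b i) (tnth b j) = (i == j)%:R) -> orthonormal_basis b.
Proof.
move=> h; split=> //; rewrite basisEfree subvf dimvf /dim /= muln1 size_tuple leqnn.
rewrite !andbT; apply/freeP => k e i.
have := braket_sumr (tnth b i) k (tnth b).
under eq_bigr => j _ do rewrite (tnth_nth 0).
rewrite e (bigD1 i) //= h eqxx mulr1 big1 => [|j ne]; last by rewrite h eq_sym (negbTE ne) mulr0.
by rewrite addr0 /braket big1 => [<-//|d _]; rewrite mxE mulr0.
Qed.

Lemma card_partition_by (I : finType) (T : choiceType) (h : I -> T) (e : I -> I -> bool) :
  (forall i j, e i j = (h i == h j)) ->
  #|equivalence_partition e [set: I]| = #|` image_fset h|.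
Proof.
move=> he; pose hh i : image_fset h := FSetSub (mem_image_fset h i).
pose cls (t : image_fset h) := [set j | hh j == t].
have -> : equivalence_partition e [set: I] = [set cls t | t in [set: image_fset h]].
  apply/setP => S; apply/imsetP/imsetP => [[i _ ->]|[t _ ->]].
    exists (hh i); rewrite ?inE //; apply/setP => j; rewrite !inE he eq_sym.
    by rewrite -(inj_eq val_inj).
  have /image_fsetP[i ei] := valP t; exists i; rewrite ?inE //; apply/setP => j.
  by rewrite !inE he -(inj_eq val_inj) /= -[val t]/(fsval t) ei eq_sym.
rewrite card_imset; first by rewrite cardsT -cardfE.
move=> t t' /setP et; have /image_fsetP[i ei] := valP t.
have := et i; rewrite !inE; have -> : hh i = t by apply: val_inj; rewrite /= ei.
by rewrite eqxx => /esym/eqP.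
Qed.

Lemma qls_QLS (X : finType) (L : X -> X -> {ffun X -> C}) v : #|X| = v -> qls L ->
  exists M : 'M['cV[C]_v]_v, is_QLS M /\ QLS_card M = #|` rays L|.
Proof.
move=> <- qL; pose M : 'M['cV[C]_#|X|]_#|X| :=
  \matrix_(i, j) \col_k L (enum_val i) (enum_val j) (enum_val k).
have hM i j i' j' : ip [ffun k => M i j k 0] [ffun k => M i' j' k 0] =
    ip (L (enum_val i) (enum_val j)) (L (enum_val i') (enum_val j')).
  rewrite /ip [RHS](reindex (@enum_val X predT)) /=; last first.
    exact: onW_bij (@enum_val_bij X).
  by apply: eq_bigr => k _; rewrite !ffunE !mxE.
exists M; split; first split.
- move=> i; apply: orthonormal_is_basis => j j'.
  by rewrite !tnth_mktuple braketE hM qL.1 (inj_eq enum_val_inj).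
- move=> i; apply: orthonormal_is_basis => j j'.
  by rewrite !tnth_mktuple braketE hM qL.2 (inj_eq enum_val_inj).
rewrite /QLS_card (@card_partition_by _ _ (fun p : 'I_#|X| * 'I_#|X| =>
   proj [ffun k => M p.1 p.2 k 0])); last first.
  move=> p q; have hu p' : ip [ffun k => M p'.1 p'.2 k 0] [ffun k => M p'.1 p'.2 k 0] = 1.
    by rewrite hM qls_unit.
  apply/asboolP/eqP => [/phase_eqP/proj_same//|/(same_proj (hu p) (hu q)) h].
  exact/phase_eqP.
have -> : rays L = image_fset (fun p : 'I_#|X| * 'I_#|X| => proj (L (enum_val p.1) (enum_val p.2))).
  apply/fsetP => t; apply/image_fsetP/image_fsetP => [[[x y] ->]|[[i j] ->]].
    by exists (enum_rank x, enum_rank y); rewrite /= !enum_rankK.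
  by exists (enum_val i, enum_val j).
apply: card_image_fset => p q.
have h1 := faithful_proj (D := 'I_#|X|); have h2 := faithful_proj (D := X).
have hu p' : ip [ffun k => M p'.1 p'.2 k 0] [ffun k => M p'.1 p'.2 k 0] = 1.
  by rewrite hM qls_unit.
rewrite h1 // h2 ?qls_unit //; split=> [[u hu' /ffunP e]|[u hu' /ffunP e]]; exists u => //.
  apply/ffunP => x; have := e (enum_rank x); rewrite !ffunE !mxE enum_rankK.
  by move=> ->.
by apply/ffunP => k; have := e (enum_val k); rewrite !ffunE !mxE => ->.
Qed.

End ToArray.

(** * Squares of small and maximal cardinality *)

Section BaseSquares.
Variable C : numClosedFieldType.

Section Coordinates.
Variables (D : finType) (b : D -> {ffun D -> C}).
Hypothesis hb : forall d d', ip (b d) (b d') = (d == d')%:R.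

(** The matrix of conjugated basis vectors is a left inverse of the matrix of basis vectors; for
    square matrices it is also a right inverse. *)
Lemma orthonormal_complete a c :
  \sum_d b d a * (b d c)^* = (a == c)%:R.
Proof.
pose M : 'M[C]_#|D| := \matrix_(i, j) (b (enum_val i) (enum_val j))^*.
pose N : 'M[C]_#|D| := \matrix_(j, i) b (enum_val i) (enum_val j).
have bij : {on predT, bijective (@enum_val D predT)} := onW_bij _ (@enum_val_bij D).
have /mulmx1C/matrixP/(_ (enum_rank a) (enum_rank c)) : M *m N = 1%:M.
  apply/matrixP => i j; rewrite !mxE -(inj_eq enum_val_inj) -hb /ip.
  by rewrite [RHS](reindex (@enum_val D predT)) //=; apply: eq_bigr => k _; rewrite !mxE.
rewrite !mxE (inj_eq enum_rank_inj) => <-; rewrite (reindex (@enum_val D predT)) //=.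
by apply: eq_bigr => k _; rewrite !mxE !enum_rankK.
Qed.

Definition coords (x : {ffun D -> C}) : {ffun D -> C} := [ffun d => ip (b d) x].

Lemma coords_isom : isom coords.
Proof.
split=> [x y|c x]; last by apply/ffunP => d; rewrite !ffunE ipZr.
transitivity (\sum_a \sum_c (x a)^* * y c * \sum_d b d a * (b d c)^*).
  rewrite /ip; under eq_bigr => d _ do rewrite !ffunE ipC /ip mulr_suml.
  rewrite exchange_big; apply: eq_bigr => a _ /=.
  under eq_bigr => d _ do rewrite mulr_sumr.
  rewrite exchange_big; apply: eq_bigr => c _ /=; rewrite mulr_sumr.
  by apply: eq_bigr => d _; ring.
rewrite /ip; apply: eq_bigr => a _.
under eq_bigr => c _ do rewrite orthonormal_complete.
rewrite (bigD1 a) //= eqxx mulr1 big1 ?addr0 // => c ne.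
by rewrite eq_sym (negbTE ne) mulr0.
Qed.

End Coordinates.

Lemma extends_basis_of_qls (D : finType) (Q : D -> D -> {ffun D -> C}) v r :
  qls Q -> #|D| = v -> #|` rays Q| = (v + r)%N -> extends_basis C v r.
Proof.
move=> hQ <- cQ D' o eD.
pose h (x : D') : D := enum_val (cast_ord eD (enum_rank x)).
pose h' (x : D) : D' := enum_val (cast_ord (esym eD) (enum_rank x)).
have hK : cancel h h' by move=> x; rewrite /h /h' enum_valK cast_ordK enum_rankK.
have h'K : cancel h' h by move=> x; rewrite /h /h' enum_valK cast_ordKV enum_rankK.
pose Q1 i j : {ffun D' -> C} := [ffun x => Q (h i) (h j) (h x)].
have ipQ i j i' j' : ip (Q1 i j) (Q1 i' j') = ip (Q (h i) (h j)) (Q (h i') (h j')).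
  rewrite /ip [RHS](reindex h) /=; last by exists h' => x _.
  by apply: eq_bigr => x _; rewrite !ffunE.
have hi : injective h := can_inj hK.
have q1 : qls Q1.
  by split=> x y y'; rewrite ipQ ?hQ.1 ?hQ.2 (inj_eq hi).
have oo k k' : ip (Q1 o k) (Q1 o k') = (k == k')%:R by exact: q1.1.
(* Taking coordinates with respect to row [o], itself an orthonormal basis, turns this row into the
   standard basis. *)
have ci := coords_isom oo.
exists (fun i j => coords (Q1 o) (Q1 i j)); split; first exact: isom_qls.
  by move=> d; apply/ffunP => e; rewrite !ffunE oo.
rewrite eD -cQ.
have -> : rays Q = image_fset (fun p : D' * D' => proj (Q (h p.1) (h p.2))).
  apply/fsetP => t; apply/image_fsetP/image_fsetP => [[[x y] ->]|[[i j] ->]].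
    by exists (h' x, h' y); rewrite /= !h'K.
  by exists (h i, h j).
have fp := faithful_proj (D := D); have fp' := faithful_proj (D := D').
have uQ p : ip (Q (h p.1) (h p.2)) (Q (h p.1) (h p.2)) = 1 by exact: qls_unit.
have uQ1 p : ip (Q1 p.1 p.2) (Q1 p.1 p.2) = 1 by exact: qls_unit.
apply: card_image_fset => p q; rewrite fp // fp' ?ci.1 //; split=> [/(isom_same_inv ci)|].
  move=> /(_ (uQ1 _) (uQ1 _))[u hu /ffunP e]; exists u => //; apply/ffunP => x.
  by have := e (h' x); rewrite !ffunE !h'K.
move=> [u hu /ffunP e]; apply: (isom_same ci); exists u => //.
by apply/ffunP => x; have := e (h x); rewrite !ffunE.
Qed.

Lemma extends_basis_latin d : extends_basis C d.+1 0.
Proof.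
apply: (@extends_basis_of_qls _ (fun i j : 'I_d.+1 => delta C (i + j))); rewrite ?card_ord //.
  split=> [x y y'|y x x']; rewrite ip_delta; first by rewrite (inj_eq (addrI x)).
  by rewrite (inj_eq (addIr y)).
rewrite addn0 -[RHS](card_ord d.+1) -(card_image_fset_inj (@proj_delta_inj C 'I_d.+1)).
congr #|` _|; apply/fsetP => t; apply/image_fsetP/image_fsetP => [[[i j] ->]|[i ->]].
  by exists (i + j).
by exists (i, 0); rewrite /= addr0.
Qed.

Lemma extends_basis_maximal d (Q : 'I_d -> 'I_d -> {ffun 'I_d -> C}) :
  qls Q -> #|` rays Q| = (d * d)%N -> extends_basis C d (d * d - d).
Proof.
move=> hQ cQ; apply: extends_basis_of_qls hQ (card_ord d) _; rewrite cQ subnKC //.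
by case: (d) => // e; rewrite leq_pmulr.
Qed.

Lemma primitive_root_exists n : (0 < n)%N -> exists w : C, n.-primitive_root w.
Proof.
move=> n0; have [r Dp] := closed_field_poly_normal ('X^n - 1 : {poly C}).
rewrite (monicP _) ?monicXnsubC // scale1r in Dp.
have [|||w _ hw] := hasP (@has_prim_root C n r n0 _ _ _); last by exists w.
- by apply/allP => z; rewrite -root_prod_XsubC -Dp.
- by rewrite -separable_prod_XsubC -Dp separable_Xn_sub_1 // pnatr_eq0 -lt0n.
- by rewrite -ltnS -(size_prod_XsubC r id) -Dp size_XnsubC.
Qed.

(** * Fourier squares, all of whose rays are distinct *)

Section Fourier.
Variables (d : nat) (w : C).
Hypotheses (d_gt3 : (3 < d)%N) (hw : d.-primitive_root w).

Lemma root_unimod k : unimod (w ^+ k).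
Proof.
have h : `|w| = 1.
  apply/eqP; rewrite -(@pexpr_eq1 _ _ d) ?normr_ge0 //; last by apply: leq_trans d_gt3.
  by rewrite -normrX (prim_expr_order hw) normr1.
by rewrite /unimod -normCKC normrX h !expr1n.
Qed.

Lemma root_inj i j : (i < d)%N -> (j < d)%N -> w ^+ i = w ^+ j -> i = j.
Proof.
by move=> hi hj /eqP; rewrite (eq_prim_root_expr hw) !modn_small // => /eqP.
Qed.

Lemma geometric_root (q : C) : q ^+ d = 1 -> q != 1 -> \sum_(k < d) q ^+ k = 0.
Proof.
move=> qd q1; have := subrX1 q d; rewrite qd subrr => /esym/eqP.
by rewrite mulf_eq0 subr_eq0 (negbTE q1) => /eqP.
Qed.

Lemma root_pow_d k : (w ^+ k) ^+ d = 1.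
Proof. by rewrite exprAC (prim_expr_order hw) expr1n. Qed.

Lemma root_orthogonal (i j : 'I_d) :
  \sum_(k < d) (w ^+ (i * k))^* * w ^+ (j * k) = (i == j)%:R * d%:R.
Proof.
have -> : \sum_(k < d) (w ^+ (i * k))^* * w ^+ (j * k) =
    \sum_(k < d) ((w ^+ i)^* * w ^+ j) ^+ k.
  by apply: eq_bigr => k _; rewrite exprMn -rmorphXn !exprM.
have [->|ne] := eqVneq i j.
  rewrite root_unimod (eq_bigr (fun=> 1)) => [|k _]; last by rewrite expr1n.
  by rewrite sumr_const card_ord mul1r.
rewrite mul0r geometric_root //.
  by rewrite exprMn -rmorphXn /= !root_pow_d conjC1 mulr1.
apply: contra ne => /eqP e; apply/eqP/val_inj/(root_inj (ltn_ord i) (ltn_ord j)).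
by rewrite -[LHS]mulr1 -e mulrA [w ^+ i * _]mulrC root_unimod mul1r.
Qed.

Definition e0 : 'I_d := Ordinal (leq_trans (isT : (0 < 4)%N) d_gt3).
Definition e1 : 'I_d := Ordinal (leq_trans (isT : (1 < 4)%N) d_gt3).
Definition e2 : 'I_d := Ordinal (leq_trans (isT : (2 < 4)%N) d_gt3).
Definition e3 : 'I_d := Ordinal (leq_trans (isT : (3 < 4)%N) d_gt3).
Definition swap01 : {perm 'I_d} := tperm e0 e1.

Definition alpha : C := (sqrtC d%:R)^-1.

Lemma alphaE : alpha^* * alpha * d%:R = 1.
Proof.
have h : sqrtC d%:R != 0 :> C.
  by rewrite sqrtC_eq0 pnatr_eq0 -lt0n; apply: leq_trans d_gt3.
rewrite /alpha fmorphV /= (geC0_conj _) ?sqrtC_ge0 ?ler0n //.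
by rewrite -{3}[d%:R]sqrtCK; field.
Qed.

(** Without the transposition the entry would depend on i + j only, giving just [d] rays. *)
Definition fourier (i j : 'I_d) : {ffun 'I_d -> C} :=
  [ffun k : 'I_d => alpha * (w ^+ (i * k) * w ^+ (j * swap01 k))].

Lemma fourier_qls : qls fourier.
Proof.
split=> [i j j'|j i i']; rewrite /ip.
  transitivity (alpha^* * alpha * \sum_(k < d) (w ^+ (j * k))^* * w ^+ (j' * k)).
    rewrite [in RHS](reindex_inj (@perm_inj _ swap01)) mulr_sumr.
    apply: eq_bigr => k _; rewrite !ffunE !rmorphM /=.
    transitivity (alpha^* * alpha * ((w ^+ (i * k))^* * w ^+ (i * k)) *
       ((w ^+ (j * swap01 k))^* * w ^+ (j' * swap01 k))); first by ring.
    by rewrite root_unimod mulr1.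
  by rewrite root_orthogonal mulrCA alphaE mulr1.
transitivity (alpha^* * alpha * \sum_(k < d) (w ^+ (i * k))^* * w ^+ (i' * k)).
  rewrite mulr_sumr; apply: eq_bigr => k _; rewrite !ffunE !rmorphM /=.
  transitivity (alpha^* * alpha * ((w ^+ (j * swap01 k))^* * w ^+ (j * swap01 k)) *
     ((w ^+ (i * k))^* * w ^+ (i' * k))); first by ring.
  by rewrite root_unimod mulr1.
by rewrite root_orthogonal mulrCA alphaE mulr1.
Qed.

(* Only the coordinates 0, 1, 2, 3 are needed: 2 and 3, fixed by the transposition,
   determine i + j and the phase, then 0 and 1 determine j and i. *)
Lemma fourier_rays : #|` rays fourier| = (d * d)%N.
Proof.
rewrite card_image_fset_inj; first by rewrite card_prod card_ord.
have a0 : alpha != 0.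
  by apply/eqP => a0; move/eqP: alphaE; rewrite a0 mulr0 mul0r eq_sym oner_eq0.
have w0 k : w ^+ k != 0 by apply: unimod_neq0; exact: root_unimod.
move=> [i j] [i' j'] /same_proj; rewrite !(qls_unit _ _ fourier_qls) /=.
move=> /(_ erefl erefl)[u hu /ffunP e].
have e' (k : 'I_d) :
    w ^+ (i * k) * w ^+ (j * swap01 k) = u * (w ^+ (i' * k) * w ^+ (j' * swap01 k)).
  by have := e k; rewrite !ffunE => h; apply: (mulfI a0); rewrite h mulrCA.
have s2 : swap01 e2 = e2 by rewrite tpermD.
have s3 : swap01 e3 = e3 by rewrite tpermD.
have := e' e2; have := e' e3; have := e' e1; have := e' e0.
rewrite s2 s3 tpermL tpermR /= !muln0 !muln1 !mul1r !mulr1 -!exprD -!mulnDl.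
set p := (i + j)%N; set q := (i' + j')%N => h0 h1 h3 h2.
have pq : w ^+ p = w ^+ q.
  move: h3; rewrite (mulnSr p 2) (mulnSr q 2) (exprD _ (p * 2)) (exprD _ (q * 2)) h2 mulrA => h.
  apply: (@mulfI _ (u * w ^+ (q * 2)%N)); last exact: h.
  by rewrite mulf_neq0 ?w0 // unimod_neq0.
have u1 : u = 1.
  by apply: (mulIf (w0 (q * 2)%N)); rewrite -h2 !exprM pq mul1r.
move: h0 h1; rewrite u1 !mul1r => h0 h1.
have -> : i = i' by apply/val_inj/(root_inj (ltn_ord i) (ltn_ord i') h1).
by have -> : j = j' by apply/val_inj/(root_inj (ltn_ord j) (ltn_ord j') h0).
Qed.

Lemma sum_swap (F : 'I_d -> C) (G : 'I_d -> C) :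
  (forall k, k != e0 -> k != e1 -> F k = G k) ->
  \sum_k F k = \sum_k G k + (F e0 - G e0) + (F e1 - G e1).
Proof.
move=> h; rewrite (bigD1 e0) //= (bigD1 e1) //= [X in _ = X + _ + _](bigD1 e0) //=.
rewrite [X in _ = _ + X + _ + _](bigD1 e1) //=.
rewrite (eq_bigr G) => [|k /andP[]]; last exact: h.
by ring.
Qed.

Lemma fourier_nonorthogonal : (4 < d)%N ->
  forall i j, i != e0 -> j != e0 -> ip (fourier e0 e0) (fourier i j) != 0.
Proof.
move=> d5 i j i0 j0; set a := w ^+ i; set b := w ^+ j.
have -> : ip (fourier e0 e0) (fourier i j) =
   alpha^* * alpha * (\sum_(k < d) (a * b) ^+ k - (1 - a) * (1 - b)).
  transitivity (alpha^* * alpha * \sum_(k < d) w ^+ (i * k) * w ^+ (j * swap01 k)).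
    rewrite /ip mulr_sumr; apply: eq_bigr => k _.
    by rewrite !ffunE /= !mul0n !expr0 !mulr1 mulrA.
  (* The sum over k is a geometric sum corrected at k = 0, 1 by (1 - a)(1 - b), and
     |(1 - a)(1 - b)| <= 4 < d. *)
  congr (_ * _); rewrite (sum_swap (G := fun k => (a * b) ^+ k)) => [|k n0 n1].
    by rewrite tpermL tpermR /= !muln0 !muln1 !expr0 !expr1 -/a -/b; ring.
  by rewrite /swap01 tpermD 1?eq_sym // exprMn !exprM.
have n1 (x : 'I_d) : x != e0 -> 1 - w ^+ x != 0.
  move=> nx; rewrite subr_eq0; apply: contra nx => /eqP e; apply/eqP/val_inj.
  by apply/esym/(root_inj (ltn_ord e0) (ltn_ord x)); rewrite expr0.
rewrite mulf_neq0 //.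
  apply/eqP => h; move/eqP: alphaE; rewrite h mul0r eq_sym oner_eq0 //.
have [ab|ab] := eqVneq (a * b) 1; last first.
  rewrite geometric_root // ?sub0r ?oppr_eq0 ?mulf_neq0 ?n1 //.
  by rewrite exprMn !root_pow_d mulr1.
rewrite ab (eq_bigr (fun=> 1)) => [|k _]; last by rewrite expr1n.
rewrite sumr_const card_ord subr_eq0; apply/eqP => h.
have nw k : `|w ^+ k| = 1.
  by apply/eqP; rewrite -(@pexpr_eq1 _ _ 2) ?normr_ge0 // normCKC root_unimod.
have le2 k : `|1 - w ^+ k| <= 2%:R.
  by apply: le_trans (ler_normB _ _) _; rewrite normr1 nw -natr1.
have : `|d%:R : C| <= 2%:R * 2%:R.
  by rewrite h normrM; apply: ler_pM; rewrite ?normr_ge0 //; exact: le2.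
by rewrite normr_nat -natrM ler_nat leqNgt d5.
Qed.

End Fourier.

Lemma extends_basis_full d : (3 < d)%N -> extends_basis C d (d * d - d).
Proof.
move=> hd; have [|w hw] := @primitive_root_exists d; first by apply: leq_trans hd.
exact: extends_basis_maximal (fourier_qls hd hw) (fourier_rays hd hw).
Qed.

(** * Squares with integer entries, checked by computation *)

Section Explicit.

(** Vectors are integer lists whose missing trailing entries read as 0; a fold over the indices lets
    the dot product compute. *)
Definition idot (d : nat) (v w : seq int) : int :=
  foldr (fun k s => v`_k * w`_k + s) 0 (iota 0 d).

Definition ivec d (v : seq int) : {ffun 'I_d -> C} := [ffun k => (v`_(val k))%:~R].

Lemma ip_ivec d v w : ip (ivec d v) (ivec d w) = (idot d v w)%:~R.
Proof.
rewrite /ip /idot.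
transitivity (\sum_(0 <= k < d) (v`_k)%:~R^* * (w`_k)%:~R : C).
  by rewrite !big_mkord; apply: eq_bigr => k _; rewrite !ffunE.
rewrite /index_iota subn0; elim: (iota 0 d) => [|k t IH]; first by rewrite big_nil.
by rewrite big_cons /= IH rmorphD rmorphM /= rmorph_int.
Qed.

Definition normalized d (v : seq int) : {ffun 'I_d -> C} :=
  vscale (sqrtC (idot d v v)%:~R)^-1 (ivec d v).

Variables (d : nat) (vs : seq (seq int)) (tau : seq (seq nat)).

Definition cell_vec (i j : nat) : seq int := nth [::] vs (nth 0%N (nth [::] tau i) j).

(** In order: orthogonal rows and columns, table indices in range, every vector used, no zero
    vector, and no two vectors parallel, the last tested by failure of equality in the
    Cauchy-Schwarz inequality. *)
Definition explicit_ok : bool :=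
  [&& all (fun i => all (fun j => all (fun k =>
        (j == k) || ((idot d (cell_vec i j) (cell_vec i k) == 0) &&
                     (idot d (cell_vec j i) (cell_vec k i) == 0)))
        (iota 0 d)) (iota 0 d)) (iota 0 d),
    all (fun i => all (fun j => (nth 0%N (nth [::] tau i) j < size vs)%N) (iota 0 d)) (iota 0 d),
    all (fun r => has (fun i => has (fun j => nth 0%N (nth [::] tau i) j == r) (iota 0 d))
      (iota 0 d)) (iota 0 (size vs)),
    all (fun r => 0 < idot d (nth [::] vs r) (nth [::] vs r)) (iota 0 (size vs))
  & all (fun r => all (fun t => (r == t) ||
       (idot d (nth [::] vs r) (nth [::] vs t) * idot d (nth [::] vs r) (nth [::] vs t) !=
        idot d (nth [::] vs r) (nth [::] vs r) * idot d (nth [::] vs t) (nth [::] vs t)))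
      (iota 0 (size vs))) (iota 0 (size vs))].

Definition explicit (i j : 'I_d) : {ffun 'I_d -> C} := normalized d (cell_vec i j).

Lemma ip_normalized v w : ip (normalized d v) (normalized d w) =
  ((sqrtC (idot d v v)%:~R)^-1)^* * (sqrtC (idot d w w)%:~R)^-1 * (idot d v w)%:~R.
Proof. by rewrite /normalized ipZr ipZl ip_ivec; ring. Qed.

Lemma normalized_unit v : 0 < idot d v v -> ip (normalized d v) (normalized d v) = 1.
Proof.
move=> h; rewrite ip_normalized.
have h0 : sqrtC (idot d v v)%:~R != 0 :> C by rewrite sqrtC_eq0 intr_eq0 gt_eqF.
rewrite fmorphV /= (geC0_conj _) ?sqrtC_ge0 ?ler0z ?ltW //.
by rewrite -{3}[_%:~R]sqrtCK; field.
Qed.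

Lemma explicit_qls : explicit_ok ->
  qls explicit /\ #|` rays explicit| = size vs.
Proof.
case/and5P => /allP h1 /allP h2 /allP h3 /allP h4 /allP h5.
have mi (i : 'I_d) : val i \in iota 0 d by rewrite mem_iota /=.
have u r : (r < size vs)%N -> 0 < idot d (nth [::] vs r) (nth [::] vs r).
  by move=> hr; apply: h4; rewrite mem_iota.
have uc (i j : 'I_d) : 0 < idot d (cell_vec i j) (cell_vec i j).
  by apply: u; have /allP := h2 _ (mi i); apply; exact: mi.
split; first split=> [i j k|i j k].
- have [->|ne] := eqVneq j k; first by rewrite normalized_unit.
  have /allP/(_ _ (mi j))/allP/(_ _ (mi k)) := h1 _ (mi i).
  rewrite (negbTE (_ : val j != val k)) //= => /andP[/eqP e _].
  by rewrite ip_normalized e mulr0.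
- have [->|ne] := eqVneq j k; first by rewrite normalized_unit.
  have /allP/(_ _ (mi j))/allP/(_ _ (mi k)) := h1 _ (mi i).
  rewrite (negbTE (_ : val j != val k)) //= => /andP[_ /eqP e].
  by rewrite ip_normalized e mulr0.
have -> : rays explicit = image_fset (fun r : 'I_(size vs) => proj (normalized d (nth [::] vs r))).
  apply/fsetP => t; apply/image_fsetP/image_fsetP => [[[i j] ->]|[r ->]].
    have /allP/(_ _ (mi j)) hr := h2 _ (mi i).
    by exists (Ordinal hr).
  have : val r \in iota 0 (size vs) by rewrite mem_iota /=.
  move/h3 => /hasP[i hi /hasP[j hj /eqP e]].
  move: hi hj; rewrite !mem_iota /= => hi hj.
  by exists (Ordinal hi, Ordinal hj); rewrite /= /explicit /cell_vec /= e.
rewrite card_image_fset_inj ?card_ord // => r t e; apply/eqP/negPn/negP => ne.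
have mr (r' : 'I_(size vs)) : val r' \in iota 0 (size vs) by rewrite mem_iota /=.
have /allP/(_ _ (mr t)) := h5 _ (mr r).
rewrite (negbTE (_ : val r != val t)) //= => /eqP; apply.
have [c _ ec] := same_proj (normalized_unit (u r (ltn_ord r)))
  (normalized_unit (u t (ltn_ord t))) e.
set x := nth [::] vs r in ec *; set y := nth [::] vs t in ec *.
have ux : 0 < idot d x x by exact: u.
(* Equal rays make the integer vectors proportional, which forces equality in the Cauchy-Schwarz
   inequality. *)
have [c' ec'] : exists c', ivec d x = vscale c' (ivec d y).
  have h0 : sqrtC (idot d x x)%:~R != 0 :> C by rewrite sqrtC_eq0 intr_eq0 gt_eqF.
  exists (sqrtC (idot d x x)%:~R * (c * (sqrtC (idot d y y)%:~R)^-1)).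
  rewrite -vscaleA -[in RHS]vscaleA -[vscale _ (ivec d y)]/(normalized d y).
  by rewrite -ec vscaleA divff // vscale1.
have e1 : (idot d x y)%:~R = c'^* * (idot d y y)%:~R :> C.
  by rewrite -ip_ivec ec' ipZl ip_ivec.
have e2 : (idot d x x)%:~R = c'^* * (c' * (idot d y y)%:~R) :> C.
  by rewrite -ip_ivec ec' ipZl ipZr ip_ivec.
have e3 : (idot d x y)%:~R = c' * (idot d y y)%:~R :> C.
  by rewrite -(rmorph_int Num.conj) -ip_ivec /= ipC ec' ipZr ip_ivec.
apply: (@intr_inj C); rewrite !rmorphM /= e2 {1}e1 e3; ring.
Qed.

End Explicit.

(** A 2 x 2 arrangement over the coordinate planes {0,1} and {2,3}; the lower two rows use the basis
    of each plane rotated by 45 degrees. *)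
Lemma extends_basis_4_4 : extends_basis C 4 4.
Proof.
have [|q c] := @explicit_qls 4 [:: [:: 1; 0; 0; 0]; [:: 0; 1; 0; 0]; [:: 0; 0; 1; 0];
  [:: 0; 0; 0; 1]; [:: 1; 1; 0; 0]; [:: 1; -1; 0; 0]; [:: 0; 0; 1; 1]; [:: 0; 0; 1; -1]]
  [:: [:: 0; 1; 2; 3]; [:: 1; 0; 3; 2]; [:: 6; 7; 4; 5]; [:: 7; 6; 5; 4]]%N.
  by vm_compute.
exact: extends_basis_of_qls q (card_ord 4) c.
Qed.

(* The first three coordinates carry a pentagon v_0, .., v_4 of consecutively
   orthogonal vectors (entries 0-4) and w_k = v_k x v_(k+1) (entries 5-9); row and
   column k contain w_k on the diagonal, v_k and v_(k+1) next to it. *)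
Lemma extends_basis_5_7 : extends_basis C 5 7.
Proof.
have [|q c] := @explicit_qls 5 [:: [:: 1; 0; 0]; [:: 0; 1; 0]; [:: 1; 0; 1];
  [:: -1; -1; 1]; [:: 0; 1; 1]; [:: 0; 0; 1]; [:: 1; 0; -1]; [:: 1; -2; -1];
  [:: -2; 1; -1]; [:: 0; 1; -1]; [:: 0; 0; 0; 1]; [:: 0; 0; 0; 0; 1]]
  [:: [:: 5; 1; 10; 11; 0]; [:: 1; 6; 2; 10; 11]; [:: 11; 2; 7; 3; 10];
      [:: 10; 11; 3; 8; 4]; [:: 0; 10; 11; 4; 9]]%N.
  by vm_compute.
exact: extends_basis_of_qls q (card_ord 5) c.
Qed.

(** The reflection in [Q o o] then moves every entry outside row and column [o]: none is orthogonal
    to [Q o o], and none is parallel since all rays differ. *)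
Definition spread (d : nat) := exists (Q : 'I_d -> 'I_d -> {ffun 'I_d -> C}) (o : 'I_d),
  [/\ qls Q, #|` rays Q| = (d * d)%N &
      forall i j, i != o -> j != o -> ip (Q o o) (Q i j) != 0].

(* The entries are the quaternions p_i q_j for two orthogonal bases p, q. *)
Lemma spread_4 : spread 4.
Proof.
pose vs : seq (seq int) := [:: [:: 1; 0; 0; 0]; [:: 0; 1; 2; 2]; [:: 0; 2; 1; -2]; [:: 0; 2; -2; 1];
  [:: 0; 1; 0; 0]; [:: -1; 0; -2; 2]; [:: -2; 0; 2; 1]; [:: -2; 0; -1; -2];
  [:: 0; 0; 1; 0]; [:: -2; 2; 0; -1]; [:: -1; -2; 0; -2]; [:: 2; 1; 0; -2];
  [:: 0; 0; 0; 1]; [:: -2; -2; 1; 0]; [:: 2; -1; 2; 0]; [:: -1; 2; 2; 0]].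
pose tau := [:: [:: 0; 1; 2; 3]; [:: 4; 5; 6; 7]; [:: 8; 9; 10; 11]; [:: 12; 13; 14; 15]]%N.
have [|q c] := @explicit_qls 4 vs tau; first by vm_compute.
exists (explicit (d := 4) vs tau), ord0; split=> // i j i0 j0.
have ii : (val i \in iota 1 3) by rewrite mem_iota /= lt0n i0 ltn_ord.
have jj : (val j \in iota 1 3) by rewrite mem_iota /= lt0n j0 ltn_ord.
have /allP/(_ _ ii)/allP/(_ _ jj) : all (fun i => all (fun j =>
   [&& 0 < idot 4 (cell_vec vs tau i j) (cell_vec vs tau i j),
       0 < idot 4 (cell_vec vs tau 0 0) (cell_vec vs tau 0 0) &
    idot 4 (cell_vec vs tau 0 0) (cell_vec vs tau i j) != 0]) (iota 1 3)) (iota 1 3).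
  by vm_compute.
move=> /and3P[h1 h2 h3]; rewrite ip_normalized !mulf_neq0 ?intr_eq0 //.
  by rewrite conjC_eq0 invr_eq0 sqrtC_eq0 intr_eq0 gt_eqF.
by rewrite invr_eq0 sqrtC_eq0 intr_eq0 gt_eqF.
Qed.

(** In the Fourier square of order 4 the entries at (0, 0) and (2, 2) are orthogonal, so that order
    is treated by [spread_4]. *)
Lemma spread_fourier d : (4 < d)%N -> spread d.
Proof.
move=> hd; have h3 : (3 < d)%N by apply: ltnW.
have [|w hw] := @primitive_root_exists d; first by apply: leq_trans hd.
exists (fourier w h3), (e0 h3); split; first exact: fourier_qls.
  exact: fourier_rays.
exact: fourier_nonorthogonal.
Qed.

End BaseSquares.

(** * Two by two block arrays *)

Section Pairs.
Variable C : numClosedFieldType.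

Definition realizable (v c : nat) := exists (X : finType) (L : X -> X -> {ffun X -> C}),
  [/\ #|X| = v, qls L & #|` rays L| = c].

Definition pair_rays m (Q : bool -> 'I_m -> 'I_m -> {ffun 'I_m -> C}) :=
  image_fset (fun p : bool * ('I_m * 'I_m) => proj (Q p.1 p.2.1 p.2.2)).

(** In a 2 x 2 block array two blocks share each coordinate half; the union of their rays is what
    counts. *)
Definition pair_union (m u : nat) := exists Q : bool -> 'I_m -> 'I_m -> {ffun 'I_m -> C},
  (forall b, qls (Q b)) /\ #|` pair_rays Q| = u.

Lemma pair_rays_cup m (Q : bool -> 'I_m -> 'I_m -> {ffun 'I_m -> C}) :
  pair_rays Q = (rays (Q true) `|` rays (Q false))%fset.
Proof.
apply/fsetP => t; rewrite in_fsetU; apply/image_fsetP/orP => [[[[] p] ->]|].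
- by left; apply/image_fsetP; exists p.
- by right; apply/image_fsetP; exists p.
by case=> /image_fsetP[p ->]; [exists (true, p) | exists (false, p)].
Qed.

(** Block (a, b) lives on the half a xor b. Rays from different halves are distinct, so the two
    counts add. *)
Lemma pair_union_realizable m u1 u2 : pair_union m u1 -> pair_union m u2 ->
  realizable (2 * m) (u1 + u2).
Proof.
move=> [Q1 [q1 c1]] [Q2 [q2 c2]].
pose X : finType := (bool * 'I_m)%type.
pose f (l : bool) (i : 'I_m) : X := (l, i).
pose g (l : bool) (x : X) : option 'I_m := if x.1 == l then Some x.2 else None.
have fK l d : g l (f l d) = Some d by rewrite /g /= eqxx.
have gK l x d : g l x = Some d -> f l d = x.
  by rewrite /g; case: x => a i /=; case: eqP => // -> [->].
pose Q l := if l then Q1 else Q2.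
have hQ l b : qls (Q l b) by case: l; [exact: q1 | exact: q2].
pose W (p : bool * bool) (x y : X) := emb (g (p.1 (+) p.2)) (Q (p.1 (+) p.2) p.1 x.2 y.2).
pose pc (x y : X) := (x.1, y.1).
pose sup (x y z : X) : Prop := z.1 = x.1 (+) y.1.
have qL : qls (fun x y => W (pc x y) x y).
  apply: (glue_qls (pc := pc) (sup := sup) _ _ (W := W)).
  - move=> x y y' z; rewrite /pc /sup => ne -> /addbI e.
    by apply: ne; rewrite e.
  - move=> y x x' z; rewrite /pc /sup => ne -> /addIb e.
    by apply: ne; rewrite e.
  move=> p; split=> [x y z <-|x y y' <- [e]|y x x' <- [e]].
  - rewrite /W /sup /= ffunE /g; case: (eqVneq z.1 (x.1 (+) y.1)) => [//|_].
    by rewrite eqxx.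
  - by rewrite /W (ip_emb (fK _) (gK _ )) (hQ _ _).1 [in RHS]/eq_op /= /pc /= e eqxx.
  - by rewrite /W (ip_emb (fK _) (gK _ )) (hQ _ _).2 [in RHS]/eq_op /= /pc /= e eqxx.
exists X, (fun x y => W (pc x y) x y); split=> //.
  by rewrite card_prod card_bool card_ord.
pose G l := image_fset (fun p : bool * ('I_m * 'I_m) => proj (emb (g l) (Q l p.1 p.2.1 p.2.2))).
have -> : rays (fun x y => W (pc x y) x y) = (G true `|` G false)%fset.
  apply/fsetP => t; rewrite in_fsetU; apply/image_fsetP/orP => [[[[a i] [b j]] ->]|].
    by rewrite /W /pc /=; case: (a (+) b); [left | right]; apply/image_fsetP; exists (a, (i, j)).
  case=> /image_fsetP[[b [i j]] ->].
    by exists ((b, i), (~~ b, j)); rewrite /W /pc /= addbN addbb.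
  by exists ((b, i), (b, j)); rewrite /W /pc /= addbb.
have cG l : #|` G l| = #|` pair_rays (Q l)|.
  apply: card_image_fset => p q; have ff := faithful_emb (C := C) (fK l) (gK l).
  have fp := faithful_proj (C := C) (D := 'I_m).
  have u p' : ip (Q l p'.1 p'.2.1 p'.2.2) (Q l p'.1 p'.2.1 p'.2.2) = 1.
    by apply: qls_unit; exact: hQ.
  by rewrite (ff _ _ (u p) (u q)) fp.
rewrite cardfsU !cG c1 c2; suff -> : (G true `&` G false)%fset = fset0.
  by rewrite cardfs0 subn0.
apply/eqP; rewrite fsetI_eq0; apply/fdisjointP => t /image_fsetP[p ->].
apply/negP => /image_fsetP[q /same_proj]; rewrite !(ip_emb (fK _) (gK _)).
rewrite !(qls_unit _ _ (hQ _ _)) => /(_ erefl erefl)[u hu /ffunP e].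
have z : Q true p.1 p.2.1 p.2.2 = [ffun=> 0].
  apply/ffunP => i; have := e (f true i).
  by rewrite (emb_f (fK true)) !ffunE /g /= mulr0.
have /eqP := qls_unit p.2.1 p.2.2 (hQ true p.1).
have /eqP := ip_eq0 (Q true p.1 p.2.1 p.2.2); rewrite z eqxx => /eqP/eqP->.
by rewrite eq_sym oner_eq0.
Qed.

(** The first square contains the basis. The second, moved off it, shares only the basis rays
    outside [K] and adds r2 + k rays. *)
Lemma pair_union_generic m r1 r2 k : (0 < m)%N -> extends_basis C m r1 -> extends_basis C m r2 ->
  (k <= m)%N -> k != 1%N -> pair_union m (m + r1 + r2 + k).
Proof.
move=> m0 /(_ _ (Ordinal m0) (card_ord m))[Q1 [q1 s1 c1]].
move=> /(_ _ (Ordinal m0) (card_ord m)) h2 km k1.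
pose K := [set i : 'I_m | (i < k)%N].
have cK : #|K| = k by exact: card_lt_ord.
have [|Q2 [q2 s2 [M [cM dM eM]]]] :=
  has_qls_move (K := K) (rays Q1) (@faithful_proj C 'I_m) h2; first by rewrite cK.
exists (fun b : bool => if b then Q1 else Q2); split; first by case.
have -> : pair_rays (fun b : bool => if b then Q1 else Q2) = (rays Q1 `|` M)%fset.
  rewrite pair_rays_cup [rays Q2]eM fsetUA; congr (_ `|` M)%fset; apply/fsetUidPl.
  apply/fsubsetP => t /image_fsetP[[d nd] /= ->].
  by apply/image_fsetP; exists (Ordinal m0, d); rewrite s1.
rewrite cardfsU c1 cM cK card_ord [(rays Q1 `&` M)%fset]fsetIC.
suff -> : (M `&` rays Q1)%fset = fset0 by rewrite cardfs0 subn0 !addnA.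
by apply/eqP; rewrite fsetI_eq0.
Qed.

Lemma image_fset_inj (I : finType) (T : choiceType) (g : I -> T) :
  #|` image_fset g| = #|I| -> injective g.
Proof.
move=> h; pose g' i : image_fset g := FSetSub (mem_image_fset g i).
have : {in predT &, injective g'}.
  apply/image_injP/eqP; rewrite -[RHS]h cardfE; apply: eq_card => t.
  rewrite inE; apply/imageP; have /image_fsetP[i e] := valP t.
  by exists i => //; apply: val_inj.
by move=> hi i j e; apply: hi => //; apply: val_inj.
Qed.

(* The second square is the reflection of the first in Q o o, which fixes row o
   and column o. *)
Lemma pair_union_spread m : spread C m -> pair_union m (m * m + m.-1 * m.-1).
Proof.
move=> [Q [o [q c no]]].
have qi : injective (fun p : 'I_m * 'I_m => proj (Q p.1 p.2)).
  by apply: image_fset_inj; rewrite -[LHS]/(#|` rays Q|) c card_prod card_ord.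
have u (p : 'I_m * 'I_m) : ip (Q p.1 p.2) (Q p.1 p.2) = 1 by exact: qls_unit.
pose fx (p : 'I_m * 'I_m) := ~~ ((p.1 != o) && (p.2 != o)).
have [|||U [U1 U2 U3]] := generic_isom (@faithful_proj C 'I_m)
   (q := fun p : 'I_m * 'I_m => Q p.1 p.2) (Z := eq (Q o o)) (fx := fx) (rays Q) u.
- by move=> z <-; rewrite (qls_unit _ _ q) oner_eq0.
- move=> [i j] z + <-; rewrite /fx /= negb_and !negbK => h.
  have [eo|ne] := eqVneq (i, j) (o, o).
    by right; exists 1; rewrite vscale1; case: eo => -> ->.
  left; case/orP: h => /eqP e; rewrite e in ne *.
    by rewrite q.1; case: eqP => // e'; rewrite e' eqxx in ne.
  by rewrite q.2; case: eqP => // e'; rewrite e' eqxx in ne.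
- move=> [i j]; rewrite /fx negbK /= => /andP[hi hj]; exists (Q o o) => //; split.
    exact: no.
  move=> a e.
  have /qi : (fun p : 'I_m * 'I_m => proj (Q p.1 p.2)) (i, j) = proj (Q (o, o).1 (o, o).2).
    by apply/proj_same/(unit_par (u (i, j)) (u (o, o)) e).
  by case=> e1 _; rewrite e1 eqxx in hi.
exists (fun b : bool => if b then Q else fun i j => U (Q i j)); split.
  by case=> //; exact: isom_qls.
pose G := image_fset (fun p : {p | ~~ fx p} => proj (U (Q (val p).1 (val p).2))).
have dG : (rays Q `&` G)%fset = fset0.
  apply/eqP; rewrite fsetI_eq0 fdisjoint_sym; apply/fdisjointP => t /image_fsetP[[p np] ->] /=.
  exact: U3.
rewrite pair_rays_cup; have -> : (rays Q `|` rays (fun i j => U (Q i j)) = rays Q `|` G)%fset.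
  apply/fsetP => t; rewrite !in_fsetU; case: (boolP (t \in rays Q)) => //= nt.
  apply/image_fsetP/image_fsetP => [[p e]|[[p np] ->]]; last by exists p.
  have [fp|nf] := boolP (fx p); last by exists (exist _ p nf).
  case/negP: nt; rewrite e (proj_same (U2 p fp)).
  exact: (mem_image_fset (fun p => proj (Q p.1 p.2))).
rewrite cardfsU dG cardfs0 subn0 c; congr (_ + _)%N.
rewrite card_image_fset_inj => [|[p np] [p' np'] /= /same_proj]; last first.
  rewrite !U1.1 !u => /(_ erefl erefl)/(isom_same_inv U1 (u p) (u p'))/proj_same/qi e.
  exact: val_inj.
rewrite card_sig (eq_card (B := setX [set~ o] [set~ o])) => [|p].
  by rewrite cardsX cardsC1 card_ord.
by rewrite !inE /fx negbK.
Qed.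

Lemma realizable_8 c : (8 <= c <= 64)%N -> c != 9%N -> realizable 8 c.
Proof.
move=> hc c9; pose rs := [:: 0; 4; 12]%N; pose ks := [:: 0; 2; 3; 4]%N.
(* 25 = 16 + 9 comes from [spread_4]; it gives 57 = 25 + 32, which the generic pairs miss. *)
pose S := 25%N :: [seq (4 + r.1 + r.2 + k)%N | r <- [seq (a, b) | a <- rs, b <- rs], k <- ks].
have hr r : r \in rs -> extends_basis C 4 r.
  rewrite !inE => /or3P[] /eqP->;
    [exact: extends_basis_latin|exact: extends_basis_4_4|exact: (@extends_basis_full C 4)].
have hS u : u \in S -> pair_union 4 u.
  rewrite inE => /orP[/eqP->|]; first exact: (pair_union_spread (spread_4 C)).
  move=> /allpairsP[[r k] [/allpairsP[[a b] [ha hb ->]] hk ->]].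
  rewrite /= in hk *.
  apply: pair_union_generic; [by []|exact: hr|exact: hr|move: hk|move: hk].
    by rewrite !inE => /or4P[] /eqP->.
  by rewrite !inE => /or4P[] /eqP->.
have : all (fun c => (c == 9) || has (fun u => has (fun w => u + w == c) S) S)%N (iota 8 57).
  by vm_compute.
move/allP/(_ c); rewrite mem_iota (negbTE c9) orFb => /(_ hc)/hasP[u hu /hasP[w hw /eqP<-]].
by apply: (@pair_union_realizable 4); exact: hS.
Qed.

Lemma realizable_10 c : (10 <= c <= 100)%N -> c != 11%N -> realizable 10 c.
Proof.
move=> hc c9; pose rs := [:: 0; 7; 20]%N; pose ks := [:: 0; 2; 3; 4; 5]%N.
(* 41 = 25 + 16 comes from the Fourier square of order 5; it gives 91 = 41 + 50, which the generic
   pairs miss. *)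
pose S := 41%N :: [seq (5 + r.1 + r.2 + k)%N | r <- [seq (a, b) | a <- rs, b <- rs], k <- ks].
have hr r : r \in rs -> extends_basis C 5 r.
  rewrite !inE => /or3P[] /eqP->;
    [exact: extends_basis_latin|exact: extends_basis_5_7|exact: (@extends_basis_full C 5)].
have hS u : u \in S -> pair_union 5 u.
  rewrite inE => /orP[/eqP->|]; first exact: (pair_union_spread (@spread_fourier C 5 isT)).
  move=> /allpairsP[[r k] [/allpairsP[[a b] [ha hb ->]] hk ->]].
  rewrite /= in hk *.
  apply: pair_union_generic; [by []|exact: hr|exact: hr|move: hk|move: hk].
    by rewrite !inE => /or4P[|||/orP[]] /eqP->.
  by rewrite !inE => /or4P[|||/orP[]] /eqP->.
have : all (fun c => (c == 11) || has (fun u => has (fun w => u + w == c) S) S)%N (iota 10 91).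
  by vm_compute.
move/allP/(_ c); rewrite mem_iota (negbTE c9) orFb => /(_ hc)/hasP[u hu /hasP[w hw /eqP<-]].
by apply: (@pair_union_realizable 5); exact: hS.
Qed.

(** Four maximal squares, with all basis rays released or, for the smaller value, all but one of
    them in one pair. *)
Lemma realizable_double m c : (3 < m)%N -> ((2 * m) ^ 2 - 1 <= c <= (2 * m) ^ 2)%N ->
  realizable (2 * m) c.
Proof.
move=> hm hc; have hf := @extends_basis_full C m hm.
pose x := ((2 * m) ^ 2 - c)%N.
have p1 : pair_union m (m + (m * m - m) + (m * m - m) + m).
  by apply: pair_union_generic => //; lia.
have p2 : pair_union m (m + (m * m - m) + (m * m - m) + (m - x)).
  by apply: pair_union_generic => //; rewrite /x; lia.
have -> : c = (m + (m * m - m) + (m * m - m) + m +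
               (m + (m * m - m) + (m * m - m) + (m - x)))%N by rewrite /x; nia.
exact: pair_union_realizable.
Qed.

End Pairs.

(** * The choice of parameters *)

Definition orthogonal_pair n (A T : 'I_n -> 'I_n -> 'I_n) :=
  [/\ forall a, injective (A a), forall b, injective (A^~ b),
      forall a, injective (T a), forall b, injective (T^~ b)
    & forall a b a' b', A a b = A a' b' -> T a b = T a' b' -> a = a' /\ b = b'].

(** Sum and difference determine a and b, because 2 is invertible modulo the odd number n + 1. *)
Lemma orthogonal_pair_odd n : ~~ odd n ->
  orthogonal_pair (fun a b : 'I_n.+1 => a + b) (fun a b : 'I_n.+1 => a - b).
Proof.
move=> on; split=> [a|b|a|b|a b a' b' e1 e2]; try exact: addrI; try exact: addIr.
  by move=> b b' /addrI/oppr_inj.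
have d x : x *+ 2 = 0 -> x = 0 :> 'I_n.+1.
  move=> h; have : x *+ n.+1 = 0 by apply: val_inj; rewrite Zp_mulrn /= modnMl.
  have -> : x *+ n.+1 = x + x *+ 2 *+ n./2.
    by rewrite -mulrnA -mulrS; congr (_ *+ _); lia.
  by rewrite h mul0rn addr0.
have e3 : a = a'.
  apply/eqP; rewrite -subr_eq0; apply/eqP/d.
  have -> : (a - a') *+ 2 = (a + b) + (a - b) - ((a' + b') + (a' - b')).
    rewrite !mulr2n !opprD !opprK.
    rewrite [a + b + _]addrACA subrr addr0 [- a' - b' + _]addrACA addNr addr0.
    by rewrite addrACA.
  by rewrite e1 e2 subrr.
by split=> //; move: e1; rewrite e3 => /addrI.
Qed.

(** Over the field of four elements, coded by bit patterns, [A] is a + b and [T] is a + w b with w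
    coded as 2. *)
Lemma orthogonal_pair_4 : exists A T : 'I_4 -> 'I_4 -> 'I_4, orthogonal_pair A T.
Proof.
pose A a b := nth 0%N (nth [::]
  [:: [:: 0; 1; 2; 3]; [:: 1; 0; 3; 2]; [:: 2; 3; 0; 1]; [:: 3; 2; 1; 0]]%N a) b.
pose T a b := nth 0%N (nth [::]
  [:: [:: 0; 2; 3; 1]; [:: 1; 3; 2; 0]; [:: 2; 0; 1; 3]; [:: 3; 1; 0; 2]]%N a) b.
pose io := iota 0 4.
have /allP ok : all (fun a => all (fun b => all (fun a' => all (fun b' =>
   [&& (A a b < 4)%N, (T a b < 4)%N,
     ((a == a') || (b == b')) && ((A a b == A a' b') || (T a b == T a' b')) ==>
       (a == a') && (b == b') &
     (A a b == A a' b') && (T a b == T a' b') ==> (a == a') && (b == b')])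
   io) io) io) io by vm_compute.
have mi (i : 'I_4) : val i \in io by rewrite mem_iota ltn_ord.
have {}ok (a b a' b' : 'I_4) := allP (allP (allP (ok _ (mi a)) _ (mi b)) _ (mi a')) _ (mi b').
have Alt (a b : 'I_4) : (A a b < 4)%N by have /and4P[] := ok a b a b.
have Tlt (a b : 'I_4) : (T a b < 4)%N by have /and4P[] := ok a b a b.
exists (fun a b => Ordinal (Alt a b)), (fun a b => Ordinal (Tlt a b)).
have st (a b a' b' : 'I_4) : (a == a') || (b == b') ->
    (A a b == A a' b') || (T a b == T a' b') -> a = a' /\ b = b'.
  move=> h1 h2; have /and4P[_ _ + _] := ok a b a' b'.
  rewrite -!(inj_eq val_inj) in h1; rewrite h1 h2 /= => /andP[/eqP e1 /eqP e2].
  by split; apply: val_inj.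
split=> [a b b'|b a a'|a b b'|b a a'|a b a' b'] /(congr1 val) /= e.
- by have [] := st a b a b'; rewrite ?eqxx ?e ?eqxx.
- by have [] := st a b a' b; rewrite ?eqxx ?orbT ?e ?eqxx.
- by have [] := st a b a b'; rewrite ?eqxx ?e ?eqxx ?orbT.
- by have [] := st a b a' b; rewrite ?eqxx ?orbT ?e ?eqxx ?orbT.
move=> /(congr1 val) /= e'; have /and4P[_ _ _] := ok a b a' b'.
rewrite e e' !eqxx /= => /andP[/eqP e1 /eqP e2].
by split; apply: val_inj.
Qed.

Lemma sum_interval (N p q x : nat) : (p <= q <= N)%N ->
  (\sum_(0 <= i < N) (if (p <= i < q)%N then x else 0) = (q - p) * x)%N.
Proof.
move=> /andP[_ qN]; suff -> M : (\sum_(0 <= i < M) (if (p <= i < q)%N then x else 0) =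
    (minn q M - p) * x)%N by rewrite (minn_idPl qN).
elim: M => [|M IH]; first by rewrite big_geq // minn0.
rewrite big_nat_recr //= IH; case: ifP => h.
  have -> : (minn q M.+1 - p = (minn q M - p).+1)%N by lia.
  by rewrite mulSn addnC.
have -> : (minn q M.+1 - p = minn q M - p)%N by lia.
by rewrite addn0.
Qed.

Lemma split_sum (N m l : nat) : (2 < m)%N -> (l <= N * m)%N -> l != 1%N ->
  exists k : nat -> nat, (forall i, (k i <= m)%N && (k i != 1%N)) /\
    (\sum_(0 <= i < N) k i)%N = l.
Proof.
move=> hm; elim: N l => [|N IH] l hl l1.
  by exists (fun=> 0%N); rewrite big_geq //; split=> //; lia.
have [x [hx x1 xl hl1 hl']] : exists x, [/\ (x <= m)%N, x != 1%N, (x <= l)%N,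
    (l - x != 1)%N & (l - x <= N * m)%N].
  have [h|h] := leqP l m; first by exists l; split=> //; lia.
  have [h'|h'] := eqVneq l m.+1; last by exists m; split=> //; lia.
  by exists m.-1; split=> //; case: N {IH} hl => [|N]; nia.
have [k [hk sk]] := IH _ hl' hl1.
exists (fun i => if i == N then x else k i); split=> [i|].
  by case: eqP => // _; rewrite hx x1.
rewrite big_nat_recr //= eqxx; rewrite (eq_big_nat _ _ (F2 := k)) ?sk ?subnK // => i.
by case: eqP => // ->; rewrite ltnn.
Qed.

(** As long as t > M > x, subtracting x leaves at least 2, so the remainder 1 never arises. *)
Lemma reduce_steps (x M N t : nat) : (x < M)%N -> (t <= M + N * x)%N -> t != 1%N ->
  exists j, [/\ (j <= N)%N, (j * x <= t)%N, (t - j * x <= M)%N & (t - j * x != 1)%N].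
Proof.
move=> xM; elim: N t => [|N IH] t ht t1; first by exists 0%N; split=> //; lia.
have [h|h] := leqP t M; first by exists 0%N; split=> //; lia.
have [||j [h1 h2 h3 h4]] := IH (t - x)%N; [lia|lia|exists j.+1; split=> //; lia].
Qed.

(** [al], [be], [ga] are the gains from a maximal square of order m, m + 1 and s, and [E] is the
    number of basis rays that may be released. Steps are removed in the order [ga], [be], [al]; each
    is smaller than the capacity left after it. *)
Lemma three_steps (E al be ga NA NB t : nat) (h3 : bool) :
  (al < E)%N -> (be < E + NA * al)%N -> (ga < E)%N ->
  (t <= E + NA * al + NB * be + h3 * ga)%N -> t != 1%N ->
  exists a b (h : bool) l, [/\ (a <= NA)%N, (b <= NB)%N, h ==> h3 & (l <= E)%N /\ l != 1%N] /\
    t = (a * al + b * be + h * ga + l)%N.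
Proof.
move=> alE beE gaE tle t1.
have gaE' : (ga < E + NA * al + NB * be)%N by rewrite -addnA ltn_addr.
have [h' [hh ht tM t1h]] := reduce_steps gaE' tle t1.
have [b [hb bt tM' t1b]] := reduce_steps beE tM t1h.
have [a [ha at' tM'' t1a]] := reduce_steps alE tM' t1b.
have [h eh hh3] : exists2 h : bool, h' = h & h ==> h3.
  by exists (h' == 1%N); move: hh; case: h3 {tle}; case: (h') => [|[|]].
exists a, b, h, (t - h' * ga - b * be - a * al)%N; split=> //.
move: (h' * ga)%N (b * be)%N (a * al)%N (congr1 (muln^~ ga) eh) ht bt at' => x y z /= <-.
by clear; lia.
Qed.

(** * Realizing every admissible cardinality *)

Section Realize.
Variable C : numClosedFieldType.

Lemma extends_basis_choice d (b : bool) : (b ==> (3 < d)%N) -> (0 < d)%N ->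
  extends_basis C d (if b then d * d - d else 0)%N.
Proof.
case: b => [/= h _|_]; first exact: extends_basis_full.
by case: d => // d _; exact: extends_basis_latin.
Qed.

Lemma product_realizable n m s (A T : 'I_n -> 'I_n -> 'I_n) a b (h : bool) l :
  orthogonal_pair A T -> (s < n)%N -> (3 < m)%N -> (h ==> (3 < s)%N) ->
  (a <= n * n - n * s)%N -> (b <= n * s)%N -> (l <= n * n.-1 * m)%N -> l != 1%N ->
  realizable C (n * m + s)
    (n * m + s + (a * (m * m - m) + b * (m.+1 * m.+1 - m.+1) + h * (s * s - s) + l))%N.
Proof.
move=> [Ar Ac Tr Tc AT] sn hm hs ha hb hl l1.
have [k [hk sk]] := split_sum (ltnW hm) hl l1.
have n0 : (0 < n)%N by apply: leq_trans sn.
pose wd (t : 'I_s) : 'I_n := widen_ord (ltnW sn) t.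
pose cf x t := invF (Tr x) (wd t).
pose rf y t := invF (Tc y) (wd t).
(* This numbering puts the transversal blocks first and the blocks with T = n - 1 last, so every
   choice of blocks becomes an interval. *)
pose ix i j := (T i j * n + A i j)%N.
pose R i := ((if (i < b)%N then m.+1 * m.+1 - m.+1 else 0) +
   (if (n * s <= i < n * s + a)%N then m * m - m else 0))%N.
pose K i := if (i < n * n.-1)%N then k i else 0%N.
have ATi : injective (fun p : 'I_n * 'I_n => (A p.1 p.2, T p.1 p.2)).
  by move=> [i j] [i' j'] /= [/AT H /H[-> ->]].
have lts i j : (T i j < s)%N = (ix i j < n * s)%N.
  rewrite /ix; have := ltn_ord (A i j); move: (nat_of_ord (A i j)) (nat_of_ord (T i j)) => x y hx.
  by apply/idP/idP => hh; nia.
have [|||||||||||L [qL cL]] := @product_qls C n m s A T cf rf Ar Ac AT _ _ _ _ _ sn _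
  (fun i j => R (ix i j)) (fun i j => K (ix i j)) (h * (s * s - s))%N.
- move=> x t; have := f_invF ATi (x, t).
  by move: (invF ATi _) => [i j] /= [e1 e2]; exists i, j.
- by move=> i t; rewrite /cf (f_invF (Tr i)).
- by move=> j t; rewrite /rf (f_invF (Tc j)).
- move=> i j t e; rewrite /cf; apply: (Tr i); rewrite (f_invF (Tr i)).
  exact: val_inj.
- move=> i j t e; rewrite /rf; apply: (Tc j); rewrite (f_invF (Tc j)).
  exact: val_inj.
- by apply: leq_trans hm.
- move=> i j; rewrite lts /R; case: (ltnP (ix i j) (n * s)) => hi /=.
    rewrite addn0; apply: (@extends_basis_choice m.+1 (ix i j < b)%N) => //.
    by rewrite (leq_trans hm) ?implybT.
  rewrite ltnNge (leq_trans hb hi) /= add0n.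
  apply: (@extends_basis_choice m (ix i j < n * s + a)%N); last by apply: leq_trans hm.
  by rewrite hm implybT.
- case: (posnP s) => [s0 D o e|s0].
    have : (0 < #|D|)%N by apply/card_gt0P; exists o.
    by rewrite e s0.
  have -> : (h * (s * s - s) = if h then s * s - s else 0)%N by case: (h); rewrite ?mul1n.
  exact: (@extends_basis_choice s h hs s0).
- by move=> ->; case: (h).
- by move=> i j; rewrite /K; case: ifP.
- move=> i j e; rewrite /K /ix e; case: ifP => // hi; exfalso; move: hi.
  by rewrite mulnC ltnNge leq_addr.
exists ('I_n * 'I_m + 'I_s)%type, L; split=> //; first by rewrite card_sum card_prod !card_ord.
rewrite cL; congr (_ + _)%N;
rewrite -[RHS]addnA -[RHS]addnA [in RHS](addnC (h * _)%N) !addnA; congr (_ + _)%N.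
have -> : (\sum_i \sum_j (R (ix i j) + K (ix i j)) = \sum_(0 <= i < n * n) (R i + K i))%N.
  rewrite pair_bigA /= big_nat_mul big_mkord.
  transitivity (\sum_(l0 < n) \sum_(t < n) (R (t * n + l0) + K (t * n + l0)))%N.
    rewrite pair_bigA (reindex (invF ATi)) /=; last first.
      by exists (fun p => (A p.1 p.2, T p.1 p.2)) => p _;
        [exact: (f_invF ATi p) | exact: (invF_f ATi p)].
    apply: eq_bigr => p _; rewrite /ix; have := f_invF ATi p.
    by case: (invF ATi p) => i j /= <-.
  rewrite exchange_big; apply: eq_bigr => t _ /=.
  rewrite -[in RHS](add0n (t * n)%N) big_addn mulSn addnK big_mkord.
  by apply: eq_bigr => i _; have -> : (i + t * n = t * n + i)%N by rewrite addnC.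
rewrite big_split /=; congr (_ + _)%N.
  rewrite /R big_split /= addnC; congr (_ + _)%N.
    by rewrite sum_interval ?addKn // leq_addr /= -leq_subRL ?leq_mul2l ?(ltnW sn) ?orbT.
  by rewrite (sum_interval (p := 0)) ?subn0 //= (leq_trans hb) // leq_mul2l (ltnW sn) orbT.
rewrite -sk (big_cat_nat (n := n * n.-1)) //= ?leq_mul2l ?leq_pred ?orbT //.
rewrite [X in (_ + X)%N]big1_seq ?addn0 => [|i]; last first.
  by rewrite mem_index_iota /K /= => /andP[hi _]; rewrite ltnNge hi.
by apply: eq_big_nat => i /andP[_ hi]; rewrite /K hi.
Qed.

(** With maximal squares everywhere and all permitted basis rays released, there are as many rays as
    cells. *)
Lemma square_total n m s : (s < n)%N ->
  (n * n.-1 * m + (n * n - n * s) * (m * m - m) + n * s * (m.+1 * m.+1 - m.+1) +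
   (s * s - s) + (n * m + s) = (n * m + s) ^ 2)%N.
Proof.
move=> sn; have sq d : (d * d - d = d * d.-1)%N by case: d => // d; rewrite mulSn addKn mulnC.
have [p np] : exists p, n = (s + p).+1 by exists (n - s).-1; lia.
rewrite !sq -mulnBr np /= subSn ?leq_addr // addKn.
case: m => [|m]; case: s {sn np} => [|s] /=; rewrite -mulnn.
all: ring.
Qed.
Lemma step_bounds n m s : (3 < m)%N -> (m <= n * n.-1)%N -> (s < n)%N ->
 [/\ (m * m - m < n * n.-1 * m)%N,
     (m.+1 * m.+1 - m.+1 < n * n.-1 * m + (n * n - n * s) * (m * m - m))%N
   & (s * s - s < n * n.-1 * m)%N].
Proof.
move=> m3 mn sn.
have h1 : (m * m <= n * n.-1 * m)%N by rewrite leq_mul2r mn orbT.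
have h4 : (m * m - m <= (n * n - n * s) * (m * m - m))%N.
  by rewrite leq_pmull // -mulnBr muln_gt0; lia.
have h5 : (4 * m <= m * m)%N by rewrite leq_mul2r m3 orbT.
have h6 : (s * s <= n * n.-1)%N by apply: leq_mul; lia.
have h7 : (n * n.-1 * 4 <= n * n.-1 * m)%N by rewrite leq_mul2l m3 orbT.
have h8 : (m.+1 * m.+1 - m.+1 = m * m + m)%N by rewrite mulSn addKn mulnS addnC.
rewrite h8; split; lia.
Qed.

(** A hole of order at most 3 is filled by a Latin square only, which costs the s^2 - s further
    rays. *)
Lemma realizable_product n m s (A T : 'I_n -> 'I_n -> 'I_n) c :
  orthogonal_pair A T -> (3 < m)%N -> (m <= n * n.-1)%N -> (s < n)%N ->
  (n * m + s <= c)%N -> c != (n * m + s).+1 ->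
  (c <= (n * m + s) ^ 2 - (if (3 < s)%N then 0 else s * s - s))%N ->
  realizable C (n * m + s) c.
Proof.
move=> hAT m3 mn sn vc c1 cv; have [alE beE gaE] := step_bounds m3 mn sn.
have [||a [b [h [l [[ha hb h3 [hl l1]] e]]]]] := @three_steps _ _ _ _ (n * n - n * s)
    (n * s) (c - (n * m + s)) (3 < s)%N alE beE gaE.
- move: cv; rewrite -(square_total m sn); case: (3 < s)%N; rewrite ?mul1n ?mul0n ?addn0.
    by rewrite subn0 leq_subLR addnC.
  by rewrite [X in (X - _)%N]addnAC addnK leq_subLR addnC.
- by move: vc c1; clear; lia.
by have := product_realizable hAT sn m3 h3 ha hb hl l1; rewrite -e subnKC.
Qed.

Lemma realizable_odd q m s c : (0 < q)%N -> (3 < m)%N -> (m <= q.*2.+1 * q.*2)%N ->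
  (s <= q.*2)%N -> (q.*2.+1 * m + s <= c)%N -> c != (q.*2.+1 * m + s).+1 ->
  (c <= (q.*2.+1 * m + s) ^ 2 - (if (3 < s)%N then 0 else s * s - s))%N ->
  realizable C (q.*2.+1 * m + s) c.
Proof.
move=> q0 hm mq sq; apply: realizable_product => //.
by apply: orthogonal_pair_odd; rewrite odd_double.
Qed.

Lemma realizable_hole q m s c : (0 < q)%N -> (3 < m)%N -> (m <= q.*2.+1 * q.*2)%N ->
  (s <= q.*2)%N -> (s < 2)%N || (3 < s)%N -> (q.*2.+1 * m + s <= c)%N ->
  c != (q.*2.+1 * m + s).+1 -> (c <= (q.*2.+1 * m + s) ^ 2)%N ->
  realizable C (q.*2.+1 * m + s) c.
Proof.
move=> q0 hm mq sq s2 vc c1 cv; apply: realizable_odd => //.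
case: ifP s2 => [_ _|_]; first by rewrite subn0.
by rewrite orbF; case: s cv {vc c1 sq} => [|[|]] //; rewrite ?subn0.
Qed.

Lemma realizable_27 c : (27 ^ 2 - 1 <= c <= 27 ^ 2)%N -> realizable C 27 c.
Proof.
move=> hc; have hp : orthogonal_pair _ _ := @orthogonal_pair_odd 2 isT.
(* Nine maximal blocks of order 9 and no hole give 27 + 9 * 72 = 675 rays; up to 54 basis rays can
   be released. *)
have h (l : nat) : (l <= 54)%N -> l != 1%N -> realizable C 27 (675 + l).
  move=> hl l1; have := @product_realizable 3 9 0 _ _ 9 0 false l hp isT isT isT isT isT hl l1.
  by congr realizable; lia.
by have -> : (c = 675 + (c - 675))%N by [lia]; apply: h; lia.
Qed.

Lemma realizable_all v c : (8 <= v)%N -> v \notin [:: 9; 11; 23]%N ->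
  (v <= c <= v ^ 2)%N -> c != v.+1 -> realizable C v c.
Proof.
move=> v8 vn /andP[vc cv] c1.
have [v56|v56] := leqP 56 v.
  (* Then s = v mod 8 + 4 lies between 4 and 11, and v >= 56 gives 2 q >= 12. *)
  pose q := ((v - 8) %/ 8)%N; pose s := (v - q.*2.+1 * 4)%N.
  have ev : (v = q.*2.+1 * 4 + s)%N by rewrite /s /q; lia.
  rewrite ev in vc cv c1 *; apply: realizable_hole vc c1 cv => //; rewrite /s /q; lia.
(* Here [s] is the block order and the hole has order 2; the values v^2 - 1 and v^2 come from a 2 x
   2 array. *)
have two m s q : (v = 2 * m)%N -> (3 < m)%N -> (0 < q)%N -> (3 < s)%N ->
    (s <= q.*2.+1 * q.*2)%N -> (2 <= q.*2)%N -> (v = q.*2.+1 * s + 2)%N -> realizable C v c.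
  move=> em hm q0 s3 hs hq ev; have [hc|hc] := leqP c (v ^ 2 - 2).
    by rewrite ev in vc hc c1 *; apply: realizable_odd vc c1 hc.
  by rewrite em in hc cv *; apply: realizable_double => //; lia.
pose good v := has (fun q => has (fun m => has (fun s =>
   [&& (m <= q.*2.+1 * q.*2)%N, (s <= q.*2)%N, (s < 2)%N || (3 < s)%N &
       v == (q.*2.+1 * m + s)%N]) (iota 0 11)) (iota 4 10)) (iota 1 5).
have /allP/(_ v) : all (fun v => [|| v \in [:: 9; 11; 23]%N,
   v \in [:: 8; 10; 14; 17; 22; 27; 38]%N | good v]) (iota 8 48) by vm_compute.
rewrite mem_iota v8 (negbTE vn) orFb => /(_ v56)/orP[|]; last first.
  move=> /hasP[q hq /hasP[m hm /hasP[s _ /and4P[h1 h2 h3 /eqP ev]]]].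
  move: hq hm; rewrite !mem_iota => /andP[q0 _] /andP[m3 _].
  by rewrite ev in vc cv c1 *; apply: realizable_hole vc c1 cv.
rewrite !inE => /or4P[/eqP e|/eqP e|/eqP e|].
- by rewrite e in vc cv c1 *; apply: realizable_8; rewrite ?vc.
- by rewrite e in vc cv c1 *; apply: realizable_10; rewrite ?vc.
- by rewrite e; move: (two 7 4 1)%N; rewrite e; apply.
move=> /or4P[/eqP e|/eqP e|/eqP e|/eqP e].
- have [A [T AT]] := orthogonal_pair_4; rewrite e in vc cv c1 *.
  exact: (@realizable_product 4 4 1 A T).
- by move: (two 11 4 2)%N; rewrite e; apply.
(* 27 = 5 * 5 + 2 is odd, so its two largest values use 27 = 3 * 9 instead. *)
- rewrite e in vc cv c1 *; have [hc|hc] := leqP c (27 ^ 2 - 2).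
    exact: (@realizable_odd 2 5 2).
  by apply: realizable_27; rewrite cv andbT; lia.
- by move: (two 19 4 4)%N; rewrite e; apply.
Qed.

End Realize.

Theorem theorem1p2 (R : realType) (v c : nat) :
  (8 <= v)%N -> v \notin [:: 9; 11; 23]%N ->
  (v <= c <= v ^ 2)%N -> c <> (v + 1)%N ->
  exists L : 'M['cV[R[i]]_v]_v, is_QLS L /\ QLS_card L = c.
Proof.
move=> v8 vn vc c1; have [|X [L [eX qL <-]]] := @realizable_all R[i] v c v8 vn vc.
  by rewrite -addn1; apply/eqP.
exact: qls_QLS eX qL.
Qed.
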